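(* Let $\tau$, $\chi_0$ and the affine toric $3$-fold $X$ be as in the context, let $\mathbf e^+$ be the number of positive edges of $\tau$ and $\mathbf e^-$ the number of negative edges of $\tau$. Let $\chi=\chi_0$ (resp. $\chi=-\chi_0$). If $\mathbf e^+=1$ (resp. $\mathbf e^-=1$), then $\dim T^1_{-\chi}(X)=0$. If $\mathbf e^+\ge2$ (resp. $\mathbf e^-\ge2$), then $\dim T^1_{-\chi}(X)=\mathbf e^+-2$ (resp. $\dim T^1_{-\chi}(X)=\mathbf e^--2$).
   Context: $\widetilde N$ is a lattice of rank $3$, $\widetilde M$ its dual lattice, $\tau\subset\widetilde N_{\mathbb Q}$ a pointed full-dimensional (3-dimensional) polyhedral cone, $\tau^\vee\subset\widetilde M_{\mathbb Q}$ its dual, and $X=\mathrm{Spec}\,\mathbb C[\tau^\vee\cap\widetilde M]$ the corresponding affine toric variety. $\chi_0\in\widetilde M$ is a primitive vector taking both positive and negative values on $\tau$, such that whenever a one-dimensional face (edge) of $\tau$ intersects one of the planes $[\chi_0=1]$, $[\chi_0=-1]$, the intersection point is a lattice point. An edge of $\tau$ is called positive (resp. negative) if $\chi_0$ takes positive (resp. negative) values on it away from the origin. $T^1(X)$ is the space of first order infinitesimal deformations: writing $\mathbb C[X]=\mathbb C[\check x_1,\dots,\check x_n]/I$ with homogeneous generators, $T^1(X)$ is the cokernel of $\mathrm{Der}\,\mathbb C[\check x_1,\dots,\check x_n]\to\mathrm{Hom}_{\mathbb C[X]}(I/I^2,\mathbb C[X])$, $\sum g_i\partial/\partial\check x_i\mapsto(g\mapsto\sum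 g_i\partial g/\partial\check x_i\bmod I)$; it is $\widetilde M$-graded (with $\deg\partial/\partial\check x_i=-\deg\check x_i$), and $T^1_{\lambda}(X)$ denotes its graded component of degree $\lambda\in\widetilde M$. *)

(* Defs.v *)
From HB Require Import structures.
From mathcomp Require Import all_boot all_order all_algebra.
From mathcomp Require Import finmap boolp classical_sets functions cardinality.
From mathcomp Require Import reals complex monalg mpoly.

Set Implicit Arguments.
Unset Strict Implicit.
Unset Printing Implicit Defensive.

Import Order.TTheory GRing.Theory Num.Theory.

Local Open Scope classical_set_scope.
Local Open Scope ring_scope.

(** * The semigroup algebra K[S] of a commutative monoid S

   The library puts a product on the finitely supported functions
   [{malg K[S]}] only when S is a [monomType]: a multiplicative monoid in which
   1 is the only invertible element.  The monoid S is here additive, so the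
   basis element << s >> is the character chi^s, and
   << s >> * << t >> = << s + t >>. *)

Definition semigroup_alg (K : nzRingType) (S : nmodType) := {malg K[S]}.

HB.instance Definition _ (K : nzRingType) (S : nmodType) :=
  GRing.Lmodule.copy (semigroup_alg K S) {malg K[S]}.

Local Notation coef := monalg.mcoeff.

Section SemigroupAlgRing.
Variables (K : nzRingType) (S : nmodType).
Local Notation A := (semigroup_alg K S).
Local Notation supp := (@monalg.msupp S K).
Implicit Types (f g h : A) (s t : S) (D E : {fset S}).
Local Open Scope fset_scope.

Definition sga_one : A := << 1 *g (0 : S)%R >>.

Definition sga_mul f g : A :=
  \sum_(s <- supp f) \sum_(t <- supp g) << coef s f * coef t g *g (s + t)%R >>.

Lemma sga_mulw D E f g : supp f `<=` D -> supp g `<=` E ->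
  sga_mul f g =
    \sum_(s <- D) \sum_(t <- E) << coef s f * coef t g *g (s + t)%R >>.
Proof.
move=> leD leE; rewrite /sga_mul (big_fset_incl _ leD) /=.
  apply: eq_bigr => s _; apply: big_fset_incl => // t _ /monalg.mcoeff_outdom ->.
  by rewrite mulr0 monalgU0.
move=> s _ /monalg.mcoeff_outdom fs.
by rewrite big1 // => t _; rewrite fs mul0r monalgU0.
Qed.

Lemma sga_mulUg a s g :
  sga_mul << a *g s >> g = \sum_(t <- supp g) << a * coef t g *g (s + t)%R >>.
Proof.
rewrite (sga_mulw monalg.msuppU_le (fsubset_refl _)) big_seq_fset1.
by apply: eq_bigr => t _; rewrite monalg.mcoeffUU.
Qed.

Lemma sga_mulgU a t f :
  sga_mul f << a *g t >> = \sum_(s <- supp f) << coef s f * a *g (s + t)%R >>.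
Proof.
rewrite (sga_mulw (fsubset_refl _) monalg.msuppU_le).
by apply: eq_bigr => s _; rewrite big_seq_fset1 monalg.mcoeffUU.
Qed.

Lemma sga_mulUU a b s t :
  sga_mul << a *g s >> << b *g t >> = << a * b *g (s + t)%R >>.
Proof.
rewrite (sga_mulw monalg.msuppU_le monalg.msuppU_le) !big_seq_fset1.
by rewrite !monalg.mcoeffUU.
Qed.

Lemma sga_mulDl : left_distributive sga_mul +%R.
Proof.
move=> f g h.
rewrite [in RHS](sga_mulw (fsubsetUl _ (supp g)) (fsubset_refl _)).
rewrite [in RHS](sga_mulw (fsubsetUr (supp f) _) (fsubset_refl _)).
rewrite (sga_mulw (monalg.msuppD_le _ _) (fsubset_refl _)) -big_split /=.
apply: eq_bigr => s _; rewrite -big_split /=; apply: eq_bigr => t _.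
by rewrite monalg.mcoeffD mulrDl monalgUD.
Qed.

Lemma sga_mulDr : right_distributive sga_mul +%R.
Proof.
move=> h f g.
rewrite [in RHS](sga_mulw (fsubset_refl _) (fsubsetUl _ (supp g))).
rewrite [in RHS](sga_mulw (fsubset_refl _) (fsubsetUr (supp f) _)).
rewrite (sga_mulw (fsubset_refl _) (monalg.msuppD_le _ _)) -big_split /=.
apply: eq_bigr => s _; rewrite -big_split /=; apply: eq_bigr => t _.
by rewrite monalg.mcoeffD mulrDr monalgUD.
Qed.

Lemma sga_mul0g : left_zero 0 sga_mul.
Proof. by move=> g; rewrite /sga_mul monalg.msupp0 big_seq_fset0. Qed.

Lemma sga_mulg0 : right_zero 0 sga_mul.
Proof.
by move=> g; rewrite /sga_mul big1 // => s _; rewrite monalg.msupp0 big_seq_fset0.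
Qed.

Lemma sga_mul1g : left_id sga_one sga_mul.
Proof.
move=> g; rewrite sga_mulUg [RHS]monalgE.
by apply: eq_bigr => t _; rewrite mul1r add0r.
Qed.

Lemma sga_mulg1 : right_id sga_one sga_mul.
Proof.
move=> g; rewrite sga_mulgU [RHS]monalgE.
by apply: eq_bigr => t _; rewrite mulr1 addr0.
Qed.

Lemma sga_mulEl f g :
  sga_mul f g = \sum_(s <- supp f) sga_mul << coef s f *g s >> g.
Proof. by apply: eq_bigr => s _; rewrite sga_mulUg. Qed.

Lemma sga_mulEr f g :
  sga_mul f g = \sum_(t <- supp g) sga_mul f << coef t g *g t >>.
Proof.
by rewrite /sga_mul exchange_big; apply: eq_bigr => t _; rewrite -sga_mulgU.
Qed.

Lemma sga_mulA : associative sga_mul.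
Proof.
move=> f g h.
rewrite [in RHS](sga_mulEl f g) sga_mulEl.
rewrite [RHS](big_morph (sga_mul^~ h)
  (fun _ _ => sga_mulDl _ _ _) (sga_mul0g _)).
apply: eq_bigr => s _.
rewrite [in LHS](sga_mulEl g h) [in RHS](sga_mulEr _ g).
rewrite [LHS](big_morph (sga_mul _)
  (fun _ _ => sga_mulDr _ _ _) (sga_mulg0 _)).
rewrite [RHS](big_morph (sga_mul^~ h)
  (fun _ _ => sga_mulDl _ _ _) (sga_mul0g _)).
apply: eq_bigr => t _.
rewrite [RHS]sga_mulEr [in LHS](sga_mulEr _ h).
rewrite [LHS](big_morph (sga_mul _)
  (fun _ _ => sga_mulDr _ _ _) (sga_mulg0 _)).
by apply: eq_bigr => u _; rewrite !sga_mulUU mulrA addrA.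
Qed.

Lemma sga_one_neq0 : sga_one != 0.
Proof. by rewrite monalgU_eq0 oner_eq0. Qed.

HB.instance Definition _ := GRing.Zmodule_isNzRing.Build A
  sga_mulA sga_mul1g sga_mulg1 sga_mulDl sga_mulDr sga_one_neq0.

Lemma sga_scaleAl (a : K) f g : a *: (f * g) = (a *: f) * g.
Proof.
rewrite [RHS](sga_mulw (monalg.msuppZ_le _ _) (fsubset_refl _)).
rewrite [f * g]/(sga_mul f g) /sga_mul scaler_sumr.
apply: eq_bigr => s _; rewrite scaler_sumr; apply: eq_bigr => t _.
apply/malgP => u; rewrite !monalg.mcoeffZ !monalg.mcoeffU.
by apply: etrans (mulrnAr _ _ _) _; congr (_ *+ _); exact: mulrA.
Qed.

HB.instance Definition _ := GRing.Lmodule_isLalgebra.Build K A sga_scaleAl.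

End SemigroupAlgRing.

Section SemigroupAlgComRing.
Variables (K : comNzRingType) (S : nmodType).
Local Notation A := (semigroup_alg K S).

Lemma sga_mulC : @commutative A A *%R.
Proof.
move=> f g; rewrite [LHS]/(sga_mul f g) [RHS]/(sga_mul g f) /sga_mul.
rewrite exchange_big /=; apply: eq_bigr => t _; apply: eq_bigr => s _.
by rewrite mulrC addrC.
Qed.

HB.instance Definition _ := GRing.PzRing_hasCommutativeMul.Build A sga_mulC.
HB.instance Definition _ := GRing.Lalgebra_isComAlgebra.Build K A.

End SemigroupAlgComRing.

(** * Rational cones

   A lattice of rank d and its dual are identified, by a choice of dual bases,
   with the integral column vectors 'cV[int]_d and row vectors 'rV[int]_d. *)

Definition pairing (d : nat) (u : 'rV[rat]_d) (v : 'cV[rat]_d) : rat :=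
  (u *m v) 0 0.

Definition ratmx (m n : nat) (A : 'M[int]_(m, n)) : 'M[rat]_(m, n) :=
  map_mx intr A.

Section Cones.
Variable d : nat.
Implicit Types (C F : set 'cV[rat]_d) (chi : 'rV[int]_d).

Definition polyhedral_cone C : Prop :=
  exists (k : nat) (v : 'I_k -> 'cV[rat]_d),
    C = [set x | exists2 a : 'I_k -> rat,
                   (forall i, 0 <= a i) & x = \sum_(i < k) a i *: v i].

Definition pointed C : Prop := forall x, C x -> C (- x) -> x = 0.

(* The dimension of C is that of its linear span U. *)
Definition cone_dim C (k : nat) : Prop :=
  exists U : {vspace 'cV[rat]_d},
    [/\ \dim U = k,
        (forall x, C x -> x \in U) &
        (forall W : {vspace 'cV[rat]_d},
           (forall x, C x -> x \in W) -> (U <= W)%VS)].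

Definition dual_cone C : set 'rV[rat]_d :=
  [set u | forall x, C x -> 0 <= pairing u x].

Definition face C F : Prop :=
  exists2 u, dual_cone C u & F = [set x | C x /\ pairing u x = 0].

Definition edge C F : Prop := face C F /\ cone_dim F 1.

Definition positive_edge C chi F : Prop :=
  edge C F /\ (forall x, F x -> x != 0 -> 0 < pairing (ratmx chi) x).

Definition negative_edge C chi F : Prop :=
  edge C F /\ (forall x, F x -> x != 0 -> pairing (ratmx chi) x < 0).

(* A polyhedral cone has finitely many faces; [fset_set] is only meaningful on
   finite sets. *)
Definition num_positive_edges C chi : nat :=
  #|` fset_set [set F | positive_edge C chi F]|.

Definition num_negative_edges C chi : nat :=
  #|` fset_set [set F | negative_edge C chi F]|.

Definition primitive chi : Prop :=
  chi != 0 /\ forall (k : nat) (m : 'rV[int]_d), chi = m *+ k -> k = 1%N.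

Definition changes_sign C chi : Prop :=
  (exists2 x, C x & 0 < pairing (ratmx chi) x) /\
  (exists2 x, C x & pairing (ratmx chi) x < 0).

Definition lattice_crossings C chi : Prop :=
  forall F x, edge C F -> F x ->
    pairing (ratmx chi) x = 1 \/ pairing (ratmx chi) x = -1 ->
    exists v : 'cV[int]_d, x = ratmx v.

End Cones.

(** * The coordinate ring of an affine toric variety *)

Section DualMonoid.
Variables (d : nat) (C : set 'cV[rat]_d).

Definition dual_lattice_pred : {pred 'rV[int]_d} :=
  fun m => `[< dual_cone C (ratmx m) >].

Lemma dual_lattice_closed : addr_closed dual_lattice_pred.
Proof.
split=> [|u v /asboolP hu /asboolP hv]; apply/asboolP => x Cx.
  by rewrite /pairing /ratmx map_mx0 mul0mx mxE.
rewrite /pairing /ratmx map_mxD mulmxDl mxE.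
by apply: addr_ge0; [exact: hu|exact: hv].
Qed.

Record dual_monoid : predArgType := DualMonoid {
  dual_monoid_val :> 'rV[int]_d;
  _ : dual_lattice_pred dual_monoid_val }.

HB.instance Definition _ := [isSub for dual_monoid_val].
HB.instance Definition _ := [Choice of dual_monoid by <:].
HB.instance Definition _ :=
  GRing.SubChoice_isSubNmodule.Build _ _ dual_monoid dual_lattice_closed.

End DualMonoid.

Notation toric_ring K C := (semigroup_alg K (dual_monoid C)).

Definition toric_homog (K : comNzRingType) (d : nat) (C : set 'cV[rat]_d)
    (m : 'rV[int]_d) : set (toric_ring K C) :=
  [set a | forall s : dual_monoid C, coef s a != 0 -> (s : 'rV[int]_d) = m].

(** * First order deformations *)

(* For linear subspaces U and W of V, the image of U in V / W has dimension k:
   the classes of b_0, ..., b_(k-1) form a basis of it. *)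
Definition image_quot_dim (K : fieldType) (V : lmodType K) (U W : set V)
    (k : nat) : Prop :=
  exists b : 'I_k -> V,
    [/\ forall i, U (b i),
        forall u, U u -> exists c : 'I_k -> K, W (u - \sum_i c i *: b i) &
        forall c : 'I_k -> K, W (\sum_i c i *: b i) -> forall i, c i = 0].

(* [gr m] is the component of degree m of a G-graded algebra A. *)
Section T1.
Variables (K : fieldType) (A : comAlgType K) (G : zmodType).
Variable gr : G -> set A.
Variables (n : nat) (x : 'I_n -> A) (deg : 'I_n -> G).
Local Notation P := {mpoly K[n]}.

Definition eval_gens (p : P) : A := mpoly.mmap (GRing.in_alg A) x p.

Definition homogeneous_generators : Prop :=
  (forall i, gr (deg i) (x i)) /\ (forall a, exists p, eval_gens p = a).

Definition relation_ideal : set P := [set p | eval_gens p = 0].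

Definition relation_ideal_sq : set P :=
  [set p | exists (k : nat) (u v : 'I_k -> P),
     (forall i, relation_ideal (u i) /\ relation_ideal (v i)) /\
     p = \sum_i u i * v i].

Definition poly_homog (m : G) : set P :=
  [set p | forall a, a \in mpoly.msupp p -> \sum_i deg i *+ a i = m].

(* An A-linear map I/I^2 -> A is given by a function on P whose values on I
   vanish on I^2, are additive, and are linear for the action of A, in which
   the class of p acts as p; values outside I are irrelevant. *)
Definition conormal_hom : set (P -> A) :=
  [set f | [/\ forall g h, relation_ideal g -> relation_ideal h ->
                 f (g + h) = f g + f h,
               forall p g, relation_ideal g -> f (p * g) = eval_gens p * f g &
               forall g, relation_ideal_sq g -> f g = 0]].

Definition conormal_hom_homog (l : G) : set (P -> A) :=
  [set f | conormal_hom f /\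
     forall m g, relation_ideal g -> poly_homog m g -> gr (m + l) (f g)].

(* The functions that agree on I with the image of a derivation
   \sum_i h_i d/dx_i of P, i.e. those that are zero in the cokernel of
   Der P -> Hom_A (I/I^2, A). *)
Definition der_image : set (P -> A) :=
  [set f | exists h : 'I_n -> P,
     forall g, relation_ideal g -> f g = eval_gens (\sum_i h i * g^`M(i))].

(* dim T^1_l = k, where T^1_l is the image in T^1 of the homomorphisms of
   degree l. *)
Definition T1_dim (l : G) (k : nat) : Prop :=
  image_quot_dim (conormal_hom_homog l) der_image k.

End T1.

(* Main.v *)
(* Write S for the monoid of lattice points of the dual cone of tau and fix
   chi = chi0; the case of -chi0 is the same.  A homomorphism I/I^2 -> K[S] of
   degree -chi extends to a derivation x_i |-> eta_i x_i chi^(-chi) with values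
   in the Laurent polynomial ring K[Z^3].  The vector eta
   defines a map into K[S] exactly when it is additive on every face
   S /\ a_j^perp, where a_1, ..., a_e are the lattice points at height chi = 1 on
   the positive edges: for m in S, m - chi is in S unless some a_j vanishes on m.
   The map is a trivial deformation exactly when eta is linear on the union of
   these faces.

   The section of tau by chi = 1 is an unbounded polygon whose vertices
   a_1, ..., a_e form a chain.  Two consecutive faces meet in a ray, and points
   common to the i-th and k-th face lie in all the faces in between.  Hence,
   along the chain, a function additive on each face and known up to the j-th
   one is determined on the next one up to a multiple of a_j.  Going from the
   first to the second face this multiple is absorbed by a linear form; the
   remaining e - 2 multiples (none if e = 1) are the coordinates on T^1. *)
From HB Require Import structures.
From mathcomp Require Import all_boot all_order all_algebra.
From mathcomp Require Import ring lra zify.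
From mathcomp Require Import finmap boolp classical_sets functions cardinality.
From mathcomp Require Import reals complex monalg mpoly.
Require Import Defs.

Set Implicit Arguments.
Unset Strict Implicit.
Unset Printing Implicit Defensive.

Import Order.TTheory GRing.Theory Num.Theory.

Local Open Scope classical_set_scope.
Local Open Scope ring_scope.

(** * Finitely generated rational cones *)

(** A homomorphism of degree -chi is first read as an additive function on the lattice of relations
    between the degrees of the generators. Those degrees generate Z^3, so this lattice is a direct
    summand of Z^n and the function extends to all exponent vectors; its values on the basis vectors
    are eta. The generators are arbitrary homogeneous ones and some may be zero. A zero generator is
    itself a relation, and the value of the homomorphism on it is matched by a separate derivation.

    The lattice condition on the edges makes the pairing of m with a_j an integer. Nonzero therefore
    means at least 1, the value of chi at a_j, and this is why m - chi can leave S only when some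
    a_j vanishes on m.

    Since chi changes sign on tau, the plane chi = 0 contains a vector c interior to tau. Taking c
    as the upward direction turns the section chi = 1 into an epigraph, and this orders its vertices
    into a chain.

    The freedom at each new facet is a linear form on the plane orthogonal to its vertex that
    vanishes on the ray shared with the previous facet. In rank 3 such forms make up a line. *)

Section Pairing.
Variable d : nat.
Implicit Types (u : 'rV[rat]_d) (x : 'cV[rat]_d).

Lemma pairingDl u1 u2 x : pairing (u1 + u2) x = pairing u1 x + pairing u2 x.
Proof. by rewrite /pairing mulmxDl mxE. Qed.

Lemma pairingDr u x1 x2 : pairing u (x1 + x2) = pairing u x1 + pairing u x2.
Proof. by rewrite /pairing mulmxDr mxE. Qed.

Lemma pairingZl a u x : pairing (a *: u) x = a * pairing u x.
Proof. by rewrite /pairing -scalemxAl mxE. Qed.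

Lemma pairingZr a u x : pairing u (a *: x) = a * pairing u x.
Proof. by rewrite /pairing -scalemxAr mxE. Qed.

Lemma pairingNl u x : pairing (- u) x = - pairing u x.
Proof. by rewrite -scaleN1r pairingZl mulN1r. Qed.

Lemma pairingNr u x : pairing u (- x) = - pairing u x.
Proof. by rewrite -scaleN1r pairingZr mulN1r. Qed.

Lemma pairing0l x : pairing 0 x = 0.
Proof. by rewrite /pairing mul0mx mxE. Qed.

Lemma pairing0r u : pairing u 0 = 0.
Proof. by rewrite /pairing mulmx0 mxE. Qed.

Definition pairingE := (pairingDl, pairingDr, pairingNl, pairingNr, pairingZl,
  pairingZr, pairing0l, pairing0r).

End Pairing.

Section FinitelyGeneratedCones.
Variable d : nat.
Implicit Types (u : 'rV[rat]_d) (x y v w : 'cV[rat]_d) (s t : seq 'cV[rat]_d).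

(** Peeling off one generator at a time makes Farkas and the other arguments structural inductions
    on the list. *)
Fixpoint cone s x : Prop :=
  if s is v :: s' then exists2 a : rat, 0 <= a & cone s' (x - a *: v)
  else x = 0.

Lemma cone0 s : cone s 0.
Proof. by elim: s => //= v s IH; exists 0; rewrite ?scale0r ?subr0. Qed.

Lemma coneD s x y : cone s x -> cone s y -> cone s (x + y).
Proof.
elim: s x y => [|v s IH] x y /=; first by move=> -> ->; rewrite addr0.
move=> [a a0 hx] [b b0 hy]; exists (a + b); first exact: addr_ge0.
by rewrite scalerDl opprD addrACA; exact: IH.
Qed.

Lemma coneZ s a x : 0 <= a -> cone s x -> cone s (a *: x).
Proof.
move=> a0; elim: s x => [|v s IH] x /=; first by move=> ->; rewrite scaler0.
move=> [b b0 hx]; exists (a * b); first exact: mulr_ge0.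
by rewrite -scalerA -scalerBr; exact: IH.
Qed.

Lemma mem_cone s v : v \in s -> cone s v.
Proof.
elim: s => //= w s IH; rewrite in_cons => /orP[/eqP->|/IH hv].
  by exists 1; rewrite // scale1r subrr; exact: cone0.
by exists 0; rewrite // scale0r subr0.
Qed.

Lemma cone_ind s (Q : 'cV[rat]_d -> Prop) :
  Q 0 -> (forall x y, Q x -> Q y -> Q (x + y)) ->
  (forall a v, v \in s -> 0 <= a -> Q (a *: v)) ->
  forall x, cone s x -> Q x.
Proof.
move=> Q0 QD; elim: s => [|v s IH] QZ x /=; first by move=> ->.
move=> [a a0 hx]; rewrite -(subrK (a *: v) x); apply: (QD).
  by apply: IH hx => b w hw; apply: QZ; rewrite in_cons hw orbT.
by apply: QZ; rewrite ?in_cons ?eqxx.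
Qed.

Lemma cone_sub s t : (forall v, v \in s -> cone t v) ->
  forall x, cone s x -> cone t x.
Proof.
move=> st; apply: cone_ind; [exact: cone0 | exact: coneD |].
by move=> a v /st hv a0; exact: coneZ.
Qed.

Lemma cone_consP v s x :
  cone (v :: s) x <-> exists a y, [/\ 0 <= a, cone s y & x = a *: v + y].
Proof.
split=> [[a a0 hx]|[a [y [a0 hy ->]]]]; first by exists a, (x - a *: v); rewrite addrCA subrr addr0.
by exists a => //; rewrite addrAC subrr add0r.
Qed.

Lemma cone_rem v s x : v \in s ->
  cone s x <-> exists a y, [/\ 0 <= a, cone (rem v s) y & x = a *: v + y].
Proof.
move=> vs; rewrite -cone_consP; have ps := perm_to_rem vs.
by split; apply: cone_sub => w ws; apply: mem_cone; rewrite ?(perm_mem ps) // -(perm_mem ps).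
Qed.

Lemma cone_pairing_ge0 s u x :
  (forall v, v \in s -> 0 <= pairing u v) -> cone s x -> 0 <= pairing u x.
Proof.
move=> us; move: x; apply: cone_ind; first by rewrite pairing0r.
  by move=> x y; rewrite pairingDr; exact: addr_ge0.
by move=> a v /us hv a0; rewrite pairingZr; exact: mulr_ge0.
Qed.

Lemma cone_pairing_eq0 s u x :
  (forall v, v \in s -> 0 < pairing u v) -> cone s x -> pairing u x = 0 -> x = 0.
Proof.
elim: s x => [|v s IH] x us //= [a a0 hx] ux.
have uv : 0 < pairing u v by apply: us; rewrite in_cons eqxx.
have us' w : w \in s -> 0 < pairing u w by move=> ws; apply: us; rewrite in_cons ws orbT.
have := cone_pairing_ge0 (fun w ws => ltW (us' w ws)) hx.
rewrite !pairingE ux sub0r oppr_ge0 => av.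
have av0 : a = 0.
  by apply/eqP; rewrite eq_le a0 andbT; rewrite -(pmulr_lle0 _ uv).
by rewrite av0 scale0r subr0 in hx; exact: IH.
Qed.

(** Induction on the number of generators. If the functional [u] found for the tail is negative on
    [v], everything is projected to the kernel of [u]. The projected [x] stays outside the projected
    cone, and the functional found there, composed with the projection, separates and vanishes on
    [v]. *)
Lemma farkas s x : ~ cone s x ->
  exists2 u, forall v, v \in s -> 0 <= pairing u v & pairing u x < 0.
Proof.
have [k] := ubnP (size s); elim: k s x => // k IH [|v s] x /=.
  move=> _ /eqP x0; exists (- x^T) => //.
  have {x0}[i xi] : exists i, x i 0 != 0.
    apply/existsP; apply: contra_neqT x0 => /existsPn x0.
    by apply/colP => i; rewrite mxE; apply/eqP; move: (x0 i); rewrite negbK.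
  rewrite pairingNl oppr_lt0 /pairing mxE (bigD1 i) //=.
  apply: ltr_wpDr; first by apply: sumr_ge0 => j _; rewrite mxE -expr2 sqr_ge0.
  by rewrite mxE -expr2 lt0r sqr_ge0 sqrf_eq0 xi.
rewrite ltnS => sk nx.
have [u us ux] : exists2 u, forall w, w \in s -> 0 <= pairing u w & pairing u x < 0.
  by apply: IH => // hx; apply: nx; exists 0; rewrite // scale0r subr0.
have [uv|uv] := lerP 0 (pairing u v).
  by exists u => // w; rewrite in_cons => /orP[/eqP->|/us].
(* Project along v onto the kernel of u. *)
pose proj w := w - (pairing u w / pairing u v) *: v.
have [||u' us' ux'] := IH (map proj s) (proj x).
- by rewrite size_map.
- move=> hx; apply: nx.
  have key y : cone (map proj s) y -> exists2 a, 0 <= a & cone s (y - a *: v).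
    elim: {sk hx IH} s us y => [|w s IHs] us y /=.
      by move=> ->; exists 0; rewrite // scale0r subr0.
    move=> [a a0 /IHs[|b b0 hb]].
      by move=> z zs; apply: us; rewrite in_cons zs orbT.
    exists (b + a * - (pairing u w / pairing u v)).
      rewrite addr_ge0 // mulr_ge0 // oppr_ge0 mulr_ge0_le0 //.
        by apply: us; rewrite in_cons eqxx.
      by rewrite invr_le0 ltW.
    exists a => //; suff -> : y - (b + a * - (pairing u w / pairing u v)) *: v - a *: w
      = y - a *: proj w - b *: v by [].
    by apply/matrixP => i j; rewrite !mxE; ring.
  have [a a0 ha] := key _ hx.
  exists (a + pairing u x / pairing u v).
    by rewrite addr_ge0 // ltW // nmulr_rgt0 // invr_lt0.
  suff -> : x - (a + pairing u x / pairing u v) *: v = proj x - a *: v by [].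
  by apply/matrixP => i j; rewrite !mxE; ring.
exists (u' - (pairing u' v / pairing u v) *: u).
  have uv0 := ltr0_neq0 uv.
  move=> w; rewrite in_cons => /orP[/eqP->|ws].
    by rewrite !pairingE divfK ?subrr.
  have := us' _ (map_f proj ws); rewrite /proj !pairingE.
  by suff -> : pairing u w / pairing u v * pairing u' v =
    pairing u' v / pairing u v * pairing u w by []; ring.
by move: ux'; rewrite /proj !pairingE; congr (_ - _ < _); ring.
Qed.

Lemma pairing_gt0_sum s t : {subset t <= s} ->
  (forall w, w \in t ->
     exists2 u, forall v, v \in s -> 0 <= pairing u v & 0 < pairing u w) ->
  exists2 u, forall v, v \in s -> 0 <= pairing u v &
             forall w, w \in t -> 0 < pairing u w.
Proof.
elim: t => [|w t IH] ts pos.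
  by exists 0 => // v _; rewrite pairing0l.
have [||u us ut] := IH.
- by move=> v vt; apply: ts; rewrite in_cons vt orbT.
- by move=> v vt; apply: pos; rewrite in_cons vt orbT.
have [|u' us' uw'] := pos w; first by rewrite in_cons eqxx.
exists (u + u') => v; rewrite pairingDl.
  by move=> vs; rewrite addr_ge0 ?us ?us'.
rewrite in_cons => /orP[/eqP->|vt]; last first.
  by rewrite ltr_wpDr ?ut // us' // ts // in_cons vt orbT.
by rewrite ltr_wpDl // us // ts // in_cons eqxx.
Qed.

Lemma polyhedral_cone_seq (C : set 'cV[rat]_d) :
  polyhedral_cone C -> exists s, forall x, C x <-> cone s x.
Proof.
move=> [k [v ->]]; exists (map v (enum 'I_k)) => x; split.
  move=> [a a0 ->]; elim/big_rec: _ => [|i y _ hy]; first exact: cone0.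
  by apply: coneD => //; apply: coneZ => //; apply/mem_cone/map_f; rewrite mem_enum.
move: x; apply: cone_ind.
- by exists (fun=> 0) => //; rewrite big1 // => i _; rewrite scale0r.
- move=> x y [a a0 ->] [b b0 ->]; exists (fun i => a i + b i).
    by move=> i; rewrite addr_ge0.
  by rewrite -big_split; apply: eq_bigr => i _; rewrite scalerDl.
- move=> a w /mapP[i _ ->] a0; exists (fun j => if j == i then a else 0).
    by move=> j; case: ifP.
  rewrite (bigD1 i) //= eqxx big1 ?addr0 // => j /negPf->; exact: scale0r.
Qed.

Lemma irredundant_generators s : exists t, (forall x, cone s x <-> cone t x) /\
  forall v, v \in t -> ~ cone (rem v t) v.
Proof.
have [k] := ubnP (size s); elim: k s => // k IH s; rewrite ltnS => sk.
have [[v vs hv]|irr] := pselect (exists2 v, v \in s & cone (rem v s) v); last first.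
  by exists s; split=> // v vs hv; apply: irr; exists v.
have [|t [st irr]] := IH (rem v s).
  by rewrite size_rem //; case: (s) vs sk.
exists t; split=> // x; rewrite -st; split; last first.
  by apply: cone_sub => w /mem_rem; exact: mem_cone.
apply: cone_sub => w ws; have [->//|wv] := eqVneq w v.
by apply: mem_cone; rewrite (perm_mem (perm_to_rem vs)) in_cons (negPf wv) in ws.
Qed.

(** * Pointed cones with irredundant generators *)

Variable s : seq 'cV[rat]_d.
Hypothesis s_pointed : forall x, cone s x -> cone s (- x) -> x = 0.
Hypothesis s_irr : forall v, v \in s -> ~ cone (rem v s) v.

Lemma generator_neq0 v : v \in s -> v != 0.
Proof.
by move=> vs; apply/eqP => v0; apply: (s_irr vs); rewrite {2}v0; exact: cone0.
Qed.

(** Pointedness keeps [- w] out of the cone for each generator [w], so Farkas gives a nonnegative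
    functional positive at [w]; the sum of these is positive on all generators. *)
Lemma generators_positive : exists u, forall v, v \in s -> 0 < pairing u v.
Proof.
have [||u _ us] := @pairing_gt0_sum s s; [by [] | | by exists u].
move=> w ws; have [|u us uw] := @farkas s (- w).
  by move=> hw; have := generator_neq0 ws; rewrite (s_pointed (mem_cone ws) hw) eqxx.
by exists u => //; rewrite pairingNr oppr_lt0 in uw.
Qed.

(** Listing both [v] and [- v] forces the functional to vanish at [v]. If Farkas failed for [- w],
    then [w + z] would be a multiple of [v] with [z] in the cone of the others. A positive multiple
    contradicts irredundancy, any other one contradicts pointedness. *)
Lemma generator_exposed v : v \in s ->
  exists2 u, pairing u v = 0 & forall w, w \in rem v s -> 0 < pairing u w.
Proof.
move=> vs; have [||u us uw] := @pairing_gt0_sum (v :: - v :: rem v s) (rem v s).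
- by move=> w ws; rewrite !in_cons ws !orbT.
- move=> w ws; have ws' := mem_rem ws.
  have [|u us uw] := @farkas (v :: - v :: rem v s) (- w); last first.
    by exists u => //; rewrite pairingNr oppr_lt0 in uw.
  move/cone_consP => [a [y [a0 /cone_consP [b [z [b0 hz ->]]] e]]].
  have {}e : w + z = (b - a) *: v.
    by rewrite -[w]opprK e; apply/matrixP => i j; rewrite !mxE; ring.
  have [ba|ba] := ltrP 0 (b - a).
    apply: (s_irr vs); have : cone (rem v s) ((b - a)^-1 *: (w + z)).
      by apply: coneZ; [rewrite invr_ge0 ltW | apply: coneD => //; exact: mem_cone].
    by rewrite e scalerA mulVf ?scale1r // gt_eqF.
  have := generator_neq0 ws'; rewrite (s_pointed (mem_cone ws')) ?eqxx //.
  have -> : - w = z + (a - b) *: v.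
    by rewrite -[z](addKr w) e -opprB scaleNr; apply/matrixP => i j; rewrite !mxE; ring.
  apply: coneD; last by apply: coneZ; [rewrite -opprB oppr_ge0 | exact: mem_cone].
  by apply: cone_sub hz => y' /mem_rem; exact: mem_cone.
exists u => //; apply/eqP; rewrite eq_le us ?in_cons ?eqxx // andbT.
by rewrite -oppr_ge0 -pairingNr us // !in_cons eqxx orbT.
Qed.

End FinitelyGeneratedCones.

(** * Edges of a pointed polyhedral cone *)

Section Edges.
Variables (d : nat) (C : set 'cV[rat]_d) (s : seq 'cV[rat]_d).
Hypothesis C_cone : forall x, C x <-> cone s x.
Hypothesis C_pointed : pointed C.
Hypothesis s_irr : forall v, v \in s -> ~ cone (rem v s) v.
Implicit Types (u : 'rV[rat]_d) (v w x a : 'cV[rat]_d).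

Let s_pointed x : cone s x -> cone s (- x) -> x = 0.
Proof. by move=> /C_cone hx /C_cone; exact: C_pointed. Qed.

Definition ray a : set 'cV[rat]_d := [set x | exists2 t : rat, 0 <= t & x = t *: a].

Lemma ray_self a : ray a a.
Proof. by exists 1; rewrite // scale1r. Qed.

Lemma rayZ (t : rat) a : 0 < t -> ray (t *: a) = ray a.
Proof.
move=> t0; apply/seteqP; split=> x [r r0 ->].
  by exists (r * t); [rewrite mulr_ge0 // ltW | rewrite scalerA].
by exists (r / t); [rewrite divr_ge0 // ltW | rewrite scalerA divfK // gt_eqF].
Qed.

Lemma exposed_ray u v x : v \in s -> pairing u v = 0 ->
  (forall w, w \in rem v s -> 0 < pairing u w) -> C x -> pairing u x = 0 -> ray v x.
Proof.
move=> vs uv us /C_cone /(cone_rem x vs) [a [y [a0 hy ->]]].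
rewrite !pairingE uv mulr0 add0r => uy; exists a => //.
by rewrite (cone_pairing_eq0 us hy uy) addr0.
Qed.

Lemma generator_mem v : v \in s -> C v.
Proof. by move=> vs; apply/C_cone/mem_cone. Qed.

Lemma cone_mem_ge0 u : (forall v, v \in s -> 0 <= pairing u v) -> dual_cone C u.
Proof. by move=> us x /C_cone; apply: cone_pairing_ge0. Qed.

Lemma exposed_ge0 u v : pairing u v = 0 ->
  (forall w, w \in rem v s -> 0 < pairing u w) ->
  forall w, w \in s -> 0 <= pairing u w.
Proof.
move=> uv us w ws; have [->|wv] := eqVneq w v; first by rewrite uv.
by apply/ltW/us; rewrite rem_mem.
Qed.

Lemma ray_edge v : v \in s -> edge C (ray v).
Proof.
move=> vs; have [u uv us] := generator_exposed s_pointed s_irr vs.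
split; first exists u; first exact/cone_mem_ge0/exposed_ge0/us.
  apply/seteqP; split=> [x [t t0 ->]|x [Cx ux]]; last exact: exposed_ray Cx ux.
  rewrite /= pairingZr uv mulr0; split=> //.
  by apply/C_cone/coneZ => //; exact: mem_cone.
exists <[v]>%VS; split; first by rewrite dim_vline (generator_neq0 s_irr vs).
  by move=> x [t _ ->]; rewrite memvZ ?memv_line.
move=> W hW; rewrite -memvE; exact/hW/ray_self.
Qed.

(** A face without generators is zero. A generator in a one-dimensional face spans its line, and
    pointedness leaves only one half of that line. *)
Lemma edge_ray F : edge C F -> exists2 v, v \in s & F = ray v.
Proof.
move=> [[u uC ->] [U [dU FU Umin]]]; set F' := (X in exists2 v, _ & X = _).
have [v vs uv] : exists2 v, v \in s & pairing u v = 0.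
  apply: contrapT => nv.
  have us v : v \in s -> 0 < pairing u v.
    move=> vs; rewrite lt0r uC ?andbT; last exact: generator_mem.
    by apply/eqP => uv; apply: nv; exists v.
  have /Umin : forall x, F' x -> x \in 0%VS.
    by move=> x [/C_cone hx ux]; rewrite (cone_pairing_eq0 us hx ux) mem0v.
  by move/dimvS; rewrite dU dimv0.
have Fv : F' v by split; [exact: generator_mem|].
exists v => //; apply/seteqP; split=> [x Fx|x [t t0 ->]]; last first.
  by split; [apply/C_cone/coneZ => //; exact: mem_cone | rewrite pairingZr uv mulr0].
have : <[v]>%VS = U.
  apply/eqP; rewrite eqEdim dU dim_vline (generator_neq0 s_irr vs) andbT.
  by rewrite -memvE; exact: FU.
move=> vU; have := FU _ Fx; rewrite -vU => /vlineP [t xt]; exists t => //.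
rewrite leNgt; apply/negP => t0; have [Cx _] := Fx.
suff x0 : x = 0.
  have /eqP := x0; rewrite xt scaler_eq0 (negPf (generator_neq0 s_irr vs)) orbF.
  by rewrite lt_eqF.
apply: C_pointed => //; rewrite xt -scaleNr.
by apply/C_cone/coneZ; [rewrite oppr_ge0 ltW | exact: mem_cone].
Qed.

Variable q : 'rV[rat]_d.

(** The vertices of the section of the cone by [q = 1]. *)
Definition positive_gens : seq 'cV[rat]_d :=
  [seq (pairing q v)^-1 *: v | v <- s & 0 < pairing q v].

Lemma positive_gensP a : a \in positive_gens ->
  exists v, [/\ v \in s, 0 < pairing q v & a = (pairing q v)^-1 *: v].
Proof. by move=> /mapP[v]; rewrite mem_filter => /andP[? ?] ->; exists v. Qed.

Lemma mem_positive_gens v : v \in s -> 0 < pairing q v ->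
  (pairing q v)^-1 *: v \in positive_gens.
Proof. by move=> vs qv; apply: (map_f (fun v => _)); rewrite mem_filter qv. Qed.

Lemma positive_gens_pairing a : a \in positive_gens -> pairing q a = 1.
Proof. by move=> /positive_gensP[v [_ qv ->]]; rewrite pairingZr mulVf // gt_eqF. Qed.

Lemma positive_gens_cone a : a \in positive_gens -> C a.
Proof.
move=> /positive_gensP[v [vs qv ->]].
by apply/C_cone/coneZ; [rewrite invr_ge0 ltW | exact: mem_cone].
Qed.

Lemma positive_gens_ray a : a \in positive_gens -> exists2 v, v \in s & ray a = ray v.
Proof. by move=> /positive_gensP[v [vs qv ->]]; exists v; rewrite ?rayZ ?invr_gt0. Qed.

Lemma generators_uniq : uniq s.
Proof.
apply: count_mem_uniq => v; have [vs|/count_memPn->//] := boolP (v \in s).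
have : v \notin rem v s by apply/negP => /mem_cone; exact: s_irr.
move/count_memPn; rewrite count_rem /= eqxx vs => /eqP; rewrite subn_eq0 => c1.
by apply/eqP; rewrite eqn_leq c1 -has_count has_pred1.
Qed.

Lemma positive_gens_exposed a : a \in positive_gens ->
  exists2 u, dual_cone C u & [/\ pairing u a = 0,
    forall x, C x -> pairing u x = 0 -> ray a x &
    exists2 v, ray a v & forall w, w \in rem v s -> 0 < pairing u w].
Proof.
move=> /positive_gensP[v [vs qv ->]].
have [u uv us] := generator_exposed s_pointed s_irr vs.
exists u; first exact/cone_mem_ge0/exposed_ge0/us.
split; first by rewrite pairingZr uv mulr0.
  by move=> x; rewrite rayZ ?invr_gt0 //; exact: exposed_ray.
by exists v => //; rewrite rayZ ?invr_gt0 //; exact: ray_self.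
Qed.

Lemma ray_inj_on x y : pairing q x = 1 -> pairing q y = 1 -> ray x = ray y -> x = y.
Proof.
move=> qx qy xy; have : ray y x by rewrite -xy; exact: ray_self.
by move=> [t _ e]; move: qx; rewrite e pairingZr qy mulr1 => ->; rewrite scale1r.
Qed.

Lemma positive_gens_uniq : uniq positive_gens.
Proof.
rewrite map_inj_in_uniq; first exact/filter_uniq/generators_uniq.
move=> v w; rewrite !mem_filter => /andP[qv vs] /andP[qw ws] e.
have rvw : ray v = ray w.
  by rewrite -(rayZ v (t := (pairing q v)^-1)) ?invr_gt0 // e rayZ ?invr_gt0.
have [//|vw] := eqVneq v w.
have [t t0 e'] : ray w v by rewrite -rvw; exact: ray_self.
exfalso; apply: (s_irr vs); rewrite e'.
by apply: coneZ => //; apply: mem_cone; rewrite -e' rem_mem // eq_sym.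
Qed.

End Edges.

(** At height 1 a ray determines its generator, so counting rays amounts to counting normalised
    generators. *)
Lemma num_positive_edgesE d (C : set 'cV[rat]_d) s (chi : 'rV[int]_d) :
  (forall x, C x <-> cone s x) -> pointed C ->
  (forall v, v \in s -> ~ cone (rem v s) v) ->
  num_positive_edges C chi = size (positive_gens s (ratmx chi)).
Proof.
move=> HC Cp irr; set E := positive_gens _ _.
have -> : num_positive_edges C chi =
    #|` fset_set (@ray d @` [set` [fset a in E]%fset])|.
  congr #|` fset_set _|; apply/seteqP; split.
    move=> F [/(edge_ray HC Cp irr)[v vs ->] Fpos].
    have qv : 0 < pairing (ratmx chi) v.
      by apply: Fpos; [exact: ray_self | exact: generator_neq0 irr _ vs].
    exists ((pairing (ratmx chi) v)^-1 *: v); last by rewrite rayZ ?invr_gt0.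
    by rewrite /= inE; exact: mem_positive_gens.
  move=> F [a]; rewrite /= inE => aE <-; have qa := positive_gens_pairing aE.
  have [v vs rav] := positive_gens_ray aE.
  split; first by rewrite rav; exact: ray_edge.
  move=> x [t t0 ->]; rewrite scaler_eq0 negb_or => /andP[tn0 _].
  by rewrite pairingZr qa mulr1 lt0r tn0.
rewrite fset_set_image // set_fsetK card_in_imfset /=; last first.
  move=> x y xE yE; have mem z : z \in [fset a in E]%fset -> pairing (ratmx chi) z = 1.
    by rewrite inE; exact: positive_gens_pairing.
  by apply: (ray_inj_on (q := ratmx chi)); exact: mem.
apply/perm_size/uniq_perm; rewrite ?fset_uniq ?positive_gens_uniq // => x.
by rewrite inE.
Qed.

(** * Integral pairing and denominators *)

Definition ipair d (m : 'rV[int]_d) (v : 'cV[int]_d) : int := (m *m v) 0 0.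

Section IntegralPairing.
Variable d : nat.
Implicit Types (m : 'rV[int]_d) (v : 'cV[int]_d).

Lemma ipairDl m1 m2 v : ipair (m1 + m2) v = ipair m1 v + ipair m2 v.
Proof. by rewrite /ipair mulmxDl mxE. Qed.

Lemma ipairNl m v : ipair (- m) v = - ipair m v.
Proof. by rewrite /ipair mulNmx mxE. Qed.

Lemma ipairMn m k v : ipair (m *+ k) v = ipair m v *+ k.
Proof. by elim: k => [|k IH]; rewrite ?mulr0n ?mulrS ?ipairDl ?IH // /ipair mul0mx mxE. Qed.

Lemma pairing_ratmx m v : pairing (ratmx m) (ratmx v) = (ipair m v)%:~R.
Proof. by rewrite /pairing /ratmx -map_mxM mxE. Qed.

Lemma ratmxD m1 m2 : ratmx (m1 + m2) = ratmx m1 + ratmx m2.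
Proof. exact: map_mxD. Qed.

Lemma ratmxN m : ratmx (- m) = - ratmx m.
Proof. exact: map_mxN. Qed.

Lemma ratmxMn m k : ratmx (m *+ k) = k%:R *: ratmx m.
Proof. by rewrite scaler_nat /ratmx raddfMn. Qed.

Lemma clear_denominators p (r : 'M[rat]_(p, d)) :
  exists (k : nat) (m : 'M[int]_(p, d)), (0 < k)%N /\ ratmx m = k%:R *: r.
Proof.
pose den := (\prod_(i < p) \prod_(j < d) `|denq (r i j)|)%N.
have den_dvd i j : exists c, den = (c * `|denq (r i j)|)%N.
  rewrite /den (bigD1 i) //= (bigD1 j) //=.
  by eexists; rewrite -mulnA mulnC; reflexivity.
exists den, (\matrix_(i, j) numq (den%:R * r i j)); split.
  by apply: prodn_gt0 => i; apply: prodn_gt0 => j; rewrite absz_gt0 denq_eq0.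
apply/matrixP => i j; rewrite !mxE.
have [c ->] := den_dvd i j.
have -> : (c * `|denq (r i j)|)%:R * r i j = (c%:Z * numq (r i j))%:~R :> rat.
  rewrite natrM -mulrA -[_%:R * r i j]mulrC intrM numqE.
  by rewrite -[in RHS](absz_denq (r i j)).
by rewrite numq_int.
Qed.

End IntegralPairing.

(** Serves to write any [y] as a difference of functionals nonnegative on [s], by adding and
    subtracting a large multiple of [u]. *)
Lemma archimedean_shift d (s : seq 'cV[rat]_d) (u y : 'rV[rat]_d) :
  (forall w, w \in s -> 0 < pairing u w) ->
  exists k : nat, forall w, w \in s -> 0 <= k%:R * pairing u w + pairing y w.
Proof.
elim: s => [|v s IH] us; first by exists 0%N.
have [|k hk] := IH; first by move=> w ws; apply: us; rewrite in_cons ws orbT.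
have uv : 0 < pairing u v by apply: us; rewrite in_cons eqxx.
pose k' := Num.bound `|- pairing y v / pairing u v|.
have hk' : - pairing y v <= k'%:R * pairing u v.
  by rewrite -ler_pdivrMr // ltW // (le_lt_trans (ler_norm _)) // archi_boundP // normr_ge0.
exists (k + k')%N => w; rewrite in_cons natrD mulrDl => /orP[/eqP->|ws].
  rewrite -addrA addr_ge0 //; first by rewrite mulr_ge0 // ltW.
  by rewrite -(opprK (pairing y v)) subr_ge0.
rewrite addrAC addr_ge0 ?hk // mulr_ge0 // ltW // us // in_cons ws orbT //.
Qed.

Lemma exists_transverse (q : 'rV[rat]_3) (c : 'cV[rat]_3) :
  q != 0 -> c != 0 -> pairing q c = 0 ->
  exists2 p : 'rV[rat]_3, pairing p c = 0 &
    forall x, pairing q x = 0 -> pairing p x = 0 -> exists t, x = t *: c.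
Proof.
pose i0 : 'I_3 := inord 0; pose i1 : 'I_3 := inord 1; pose i2 : 'I_3 := inord 2.
have E (u : 'rV[rat]_3) (x : 'cV[rat]_3) :
    pairing u x = u 0 i0 * x i0 0 + u 0 i1 * x i1 0 + u 0 i2 * x i2 0.
  rewrite /pairing mxE !big_ord_recl big_ord0 addr0 addrA.
  by congr (_ * _ + _ * _ + _ * _); congr (_ _ _); apply/val_inj; rewrite /= inordK.
have I3 (i : 'I_3) : [\/ i = i0, i = i1 | i = i2].
  case: i => [[|[|[|//]]] hi]; [constructor 1|constructor 2|constructor 3];
  by apply/val_inj; rewrite /= inordK.
have nz (a b e : rat) : [|| a != 0, b != 0 | e != 0] -> a ^+ 2 + b ^+ 2 + e ^+ 2 != 0.
  move=> h; rewrite gt_eqF // lt0r !addr_ge0 ?sqr_ge0 // andbT.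
  rewrite !paddr_eq0 ?addr_ge0 ?sqr_ge0 // !sqrf_eq0.
  by move: h; do 3!case: (_ == 0).
move=> qn0 cn0.
have qn : q 0 i0 ^+ 2 + q 0 i1 ^+ 2 + q 0 i2 ^+ 2 != 0.
  apply/nz; apply: contraNT qn0; rewrite !negb_or !negbK => /and3P[/eqP h0 /eqP h1 /eqP h2].
  by apply/eqP/rowP => i; rewrite mxE; case: (I3 i) => ->.
have cn : c i0 0 ^+ 2 + c i1 0 ^+ 2 + c i2 0 ^+ 2 != 0.
  apply/nz; apply: contraNT cn0; rewrite !negb_or !negbK => /and3P[/eqP h0 /eqP h1 /eqP h2].
  by apply/eqP/colP => i; rewrite mxE; case: (I3 i) => ->.
rewrite E => qc.
(* The cross product of c and q. *)
pose p : 'rV[rat]_3 := \row_i (if i == i0 then c i1 0 * q 0 i2 - c i2 0 * q 0 i1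
  else if i == i1 then c i2 0 * q 0 i0 - c i0 0 * q 0 i2
  else c i0 0 * q 0 i1 - c i1 0 * q 0 i0).
have i10 : (i1 == i0) = false by rewrite -val_eqE /= !inordK.
have i20 : (i2 == i0) = false by rewrite -val_eqE /= !inordK.
have i21 : (i2 == i1) = false by rewrite -val_eqE /= !inordK.
exists p; first by rewrite E !mxE eqxx i10 i20 i21 eqxx; ring.
move=> x; rewrite !E !mxE eqxx i10 i20 i21 eqxx => qx px.
move: qn cn qc qx px.
set q0 := q 0 i0; set q1 := q 0 i1; set q2 := q 0 i2.
set c0 := c i0 0; set c1 := c i1 0; set c2 := c i2 0.
set x0 := x i0 0; set x1 := x i1 0; set x2 := x i2 0.
move=> qn cn qc qx px.
pose Q := q0 * c0 + q1 * c1 + q2 * c2; pose X := q0 * x0 + q1 * x1 + q2 * x2.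
pose P := q0 * (x1 * c2 - x2 * c1) + q1 * (x2 * c0 - x0 * c2) + q2 * (x0 * c1 - x1 * c0).
have Q0 : Q = 0 by []. have X0 : X = 0 by [].
have P0 : P = 0 by rewrite -px /P; ring.
(* [P] is the scalar product of q with the cross product of x and c. As q is orthogonal to x and to
   c, this cross product is parallel to q, and [P = 0] makes it vanish. Its three coordinates
   follow, each multiplied by the squared norm of q; then x is its own orthogonal projection onto
   c. *)
have z12 : x1 * c2 = x2 * c1.
  apply/eqP; rewrite -subr_eq0 -(mulIr_eq0 _ (mulIf qn)); apply/eqP.
  transitivity (q0 * P - ((q1 * x2 - q2 * x1) * Q - (q1 * c2 - q2 * c1) * X)).
    by rewrite /P /Q /X; ring.
  by rewrite P0 Q0 X0; ring.
have z20 : x2 * c0 = x0 * c2.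
  apply/eqP; rewrite -subr_eq0 -(mulIr_eq0 _ (mulIf qn)); apply/eqP.
  transitivity (q1 * P - ((q2 * x0 - q0 * x2) * Q - (q2 * c0 - q0 * c2) * X)).
    by rewrite /P /Q /X; ring.
  by rewrite P0 Q0 X0; ring.
have z01 : x0 * c1 = x1 * c0.
  apply/eqP; rewrite -subr_eq0 -(mulIr_eq0 _ (mulIf qn)); apply/eqP.
  transitivity (q2 * P - ((q0 * x1 - q1 * x0) * Q - (q0 * c1 - q1 * c0) * X)).
    by rewrite /P /Q /X; ring.
  by rewrite P0 Q0 X0; ring.
exists ((x0 * c0 + x1 * c1 + x2 * c2) / (c0 ^+ 2 + c1 ^+ 2 + c2 ^+ 2)).
have scal (y y0 : rat) : y * (c0 ^+ 2 + c1 ^+ 2 + c2 ^+ 2) = (x0 * c0 + x1 * c1 + x2 * c2) * y0 ->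
    y = (x0 * c0 + x1 * c1 + x2 * c2) / (c0 ^+ 2 + c1 ^+ 2 + c2 ^+ 2) * y0.
  by move=> e; rewrite mulrAC -e mulfK.
apply/colP => i; rewrite mxE; apply: scal.
case: (I3 i) => ->; rewrite -/x0 -/x1 -/x2 -/c0 -/c1 -/c2.
- transitivity (x0 * c0 * c0 + c1 * (x0 * c1) + c2 * (x0 * c2)); first by ring.
  by rewrite z01 -z20; ring.
- transitivity (x1 * c1 * c1 + c0 * (x1 * c0) + c2 * (x1 * c2)); first by ring.
  by rewrite -z01 z12; ring.
- transitivity (x2 * c2 * c2 + c0 * (x2 * c0) + c1 * (x2 * c1)); first by ring.
  by rewrite z20 -z12; ring.
Qed.

(** * The chain of positive edges in dimension three *)

(** The interface between geometry and algebra: apart from general facts on the monoid S and on Z^3,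
    the computation of T^1 sees the cone only through these properties. The field [chain_facet_span]
    makes the lattice points of a facet generate the plane that contains it. *)
Record edge_chain d (S : pred 'rV[int]_d) (chi : 'rV[int]_d) (e : nat)
    (a : nat -> 'cV[int]_d) : Prop := EdgeChain {
  chain_height : forall j, (j < e)%N -> ipair chi (a j) = 1;
  chain_ge0 : forall m j, S m -> (j < e)%N -> 0 <= ipair m (a j);
  chain_shift : forall m, S m ->
    S (m - chi) <-> forall j, (j < e)%N -> ipair m (a j) != 0;
  chain_convex : forall m i j k, (i <= j)%N -> (j <= k)%N -> (k < e)%N -> S m ->
    ipair m (a i) = 0 -> ipair m (a k) = 0 -> ipair m (a j) = 0;
  chain_consecutive : forall j, (j.+1 < e)%N ->
    exists u, [/\ S u, u != 0, ipair u (a j) = 0 & ipair u (a j.+1) = 0];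
  chain_exposed : forall j, (j < e)%N -> exists u, [/\ S u, ipair u (a j) = 0 &
    forall i, (i < e)%N -> i != j -> 0 < ipair u (a i)];
  chain_facet_span : forall m j, (j < e)%N -> ipair m (a j) = 0 ->
    exists u1 u2, [/\ S u1, S u2, ipair u1 (a j) = 0, ipair u2 (a j) = 0 &
      m = u1 - u2] }.

(** * Lattice points of the dual cone *)

Section DualLattice.
Variables (d : nat) (C : set 'cV[rat]_d) (s : seq 'cV[rat]_d).
Hypothesis C_cone : forall x, C x <-> cone s x.

Lemma dual_latticeP m : reflect (forall v, v \in s -> 0 <= pairing (ratmx m) v)
  (dual_lattice_pred C m).
Proof.
apply: (iffP (asboolP _)) => [h v vs|h]; first exact/h/(generator_mem C_cone).
exact: cone_mem_ge0.
Qed.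

Lemma dual_lattice_scale (u : 'rV[rat]_d) : (forall v, v \in s -> 0 <= pairing u v) ->
  exists (k : nat) (m : 'rV[int]_d),
    [/\ (0 < k)%N, ratmx m = k%:R *: u & dual_lattice_pred C m].
Proof.
move=> us; have [k [m [k0 mk]]] := clear_denominators u; exists k, m; split=> //.
by apply/dual_latticeP => v vs; rewrite mk pairingZl mulr_ge0 ?us.
Qed.

(** A lattice functional [p] strictly positive on the generators exists by pointedness; [p *+ N + m]
    is in the dual cone for large N. *)
Lemma dual_lattice_generates m : pointed C ->
  (forall v, v \in s -> ~ cone (rem v s) v) ->
  exists u1 u2, [/\ dual_lattice_pred C u1, dual_lattice_pred C u2 & m = u1 - u2].
Proof.
move=> Cp irr; have [|u us] := generators_positive (s := s) _ irr.
  by move=> x /C_cone hx /C_cone; exact: Cp.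
have [k [p [k0 pk Sp]]] := dual_lattice_scale (fun v vs => ltW (us v vs)).
have [|N hN] := @archimedean_shift _ s (ratmx p) (ratmx m).
  by move=> w ws; rewrite pk pairingZl mulr_gt0 ?ltr0n ?us.
exists (p *+ N + m), (p *+ N); split; last by rewrite addrAC subrr add0r.
  by apply/dual_latticeP => w ws; rewrite ratmxD ratmxMn pairingDl pairingZl hN.
apply/dual_latticeP => w ws; rewrite ratmxMn pairingZl mulr_ge0 //.
by move/dual_latticeP: Sp; apply.
Qed.

End DualLattice.

Lemma full_dim_functional0 d (C : set 'cV[rat]_d) s (u : 'rV[rat]_d) :
  (forall x, C x <-> cone s x) -> cone_dim C d ->
  (forall v, v \in s -> pairing u v = 0) -> u = 0.
Proof.
move=> HC [U [dU _ Umin]] us.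
have Cu x : C x -> x \in lker (linfun (mulmx u : 'cV[rat]_d -> 'cV[rat]_1)).
  move=> /HC hx; rewrite memv_ker lfunE /=; apply/eqP.
  move: x hx; apply: cone_ind => [|x y hx hy|t v /us uv t0]; rewrite ?mulmx0 //.
    by rewrite mulmxDr hx hy addr0.
  rewrite -scalemxAr (_ : u *m v = 0) ?scaler0 //.
  by apply/matrixP => i j; rewrite !ord1 [RHS]mxE.
have /subvP UW := Umin _ Cu.
have Ufull : U = fullv by apply/eqP; rewrite eqEdim subvf dU dimvf /dim /= muln1.
apply/rowP => j; rewrite mxE.
have : (delta_mx j 0 : 'cV[rat]_d) \in U by rewrite Ufull memvf.
move/UW; rewrite memv_ker lfunE /= -colE => /eqP/matrixP/(_ 0 0).
by rewrite !mxE.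
Qed.

(** * The planar section by chi = 1 *)

Section Dim3.
Variables (C : set 'cV[rat]_3) (s : seq 'cV[rat]_3) (chi : 'rV[int]_3).
Hypothesis C_cone : forall x, C x <-> cone s x.
Hypothesis C_pointed : pointed C.
Hypothesis s_irr : forall v, v \in s -> ~ cone (rem v s) v.
Hypothesis C_full : cone_dim C 3.
Hypothesis chi_sign : changes_sign C chi.
Local Notation q := (ratmx chi).
Implicit Types (u : 'rV[rat]_3) (v w x : 'cV[rat]_3).

Let CD x y : C x -> C y -> C (x + y).
Proof. by move=> /C_cone hx /C_cone hy; apply/C_cone/coneD. Qed.

Let CZ (t : rat) x : 0 <= t -> C x -> C (t *: x).
Proof. by move=> t0 /C_cone hx; apply/C_cone/coneZ. Qed.

(** The sum of the generators is interior, and interior points stay interior when elements of the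
    cone are added. A multiple of an element on which chi has the opposite sign brings the height
    down to 0. Interiority is expressed by the absence of nonzero nonnegative functionals vanishing
    at [c]. *)
Lemma exists_interior_kernel : exists c, [/\ C c, pairing q c = 0 &
  forall u, (forall x, C x -> 0 <= pairing u x) -> pairing u c = 0 -> u = 0].
Proof.
pose c0 := \sum_(v <- s) v.
have Cc0 : C c0.
  rewrite /c0 big_seq; elim/big_rec: _ => [|v y vs hy]; first exact/C_cone/cone0.
  by apply: CD => //; exact: generator_mem C_cone _ vs.
have int0 u : (forall x, C x -> 0 <= pairing u x) -> pairing u c0 = 0 -> u = 0.
  move=> uC uc0; apply: (full_dim_functional0 C_cone C_full) => v vs.
  have : pairing u c0 = \sum_(w <- s) pairing u w.
    by apply: (big_morph (pairing u)); [exact: pairingDr | exact: pairing0r].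
  rewrite uc0 => /esym/eqP; rewrite big_seq psumr_eq0; last first.
    by move=> w ws; apply/uC/(generator_mem C_cone).
  by move=> /allP/(_ v vs); rewrite vs => /eqP.
have [z [Cz qz]] : exists z, C z /\ exists2 t : rat, 0 <= t & pairing q c0 + t * pairing q z = 0.
  have [[x Cx qx] [y Cy qy]] := chi_sign.
  have [q0|q0] := lerP 0 (pairing q c0).
    exists y; split=> //; exists (pairing q c0 / - pairing q y).
      by rewrite divr_ge0 // oppr_ge0 ltW.
    by rewrite invrN mulrN mulNr divfK ?subrr // lt_eqF.
  exists x; split=> //; exists (- pairing q c0 / pairing q x).
    by rewrite divr_ge0 ?oppr_ge0 // ltW.
  by rewrite divfK ?subrr // gt_eqF.
have [t t0 e] := qz; exists (c0 + t *: z); split.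
- by apply: CD => //; exact: CZ.
- by rewrite !pairingE.
move=> u uC; rewrite !pairingE => uc; apply: int0 => //.
have := uC _ Cc0; have := mulr_ge0 t0 (uC _ Cz); move: uc; lra.
Qed.

Local Notation E0 := (positive_gens s q).

Lemma chain_setup : exists (p : 'rV[rat]_3) (c : 'cV[rat]_3), [/\ C c,
  pairing q c = 0, pairing p c = 0,
  forall u, (forall x, C x -> 0 <= pairing u x) -> pairing u c = 0 -> u = 0 &
  c != 0 /\ forall x y, pairing q x = pairing q y -> pairing p x = pairing p y ->
    exists t, x = y + t *: c].
Proof.
have [c [Cc qc cint]] := exists_interior_kernel.
have q0 : q != 0.
  have [[x _ qx] _] := chi_sign; apply: contraTneq qx => ->.
  by rewrite pairing0l ltxx.
have c0 : c != 0.
  apply: contra_neq q0 => c0; have [u us] : exists u, forall v, v \in s -> 0 < pairing u v.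
    apply: generators_positive s_irr => x /C_cone hx /C_cone; exact: C_pointed.
  have u0 : u = 0.
    apply: cint; last by rewrite c0 pairing0r.
    by apply: (cone_mem_ge0 C_cone) => v /us/ltW.
  apply: (full_dim_functional0 C_cone C_full) => v /us.
  by rewrite u0 pairing0l ltxx.
have [p pc pq] := exists_transverse q0 c0 qc.
exists p, c; split=> //; split=> // x y qxy pxy.
have [||t xy] := pq (x - y); rewrite ?pairingE ?qxy ?pxy ?subrr //.
by exists t; rewrite -xy addrC subrK.
Qed.

(* In the plane q = 1 we use p as the abscissa and c as the vertical direction:
   the section of C is then the epigraph of a convex function of p. *)
Variables (p : 'rV[rat]_3) (c : 'cV[rat]_3).
Hypothesis Cc : C c.
Hypothesis qc : pairing q c = 0.
Hypothesis pc : pairing p c = 0.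
Hypothesis c_interior : forall u, (forall x, C x -> 0 <= pairing u x) ->
  pairing u c = 0 -> u = 0.
Hypothesis cn0 : c != 0.
Hypothesis coord : forall x y, pairing q x = pairing q y -> pairing p x = pairing p y ->
    exists t, x = y + t *: c.

(** A zero of [u] at [c] would place [c] on the ray of [a]; since [q] is 0 at [c], it would be the
    origin. *)
Lemma exposed_interior_gt0 u a : a \in E0 -> dual_cone C u ->
  (forall x, C x -> pairing u x = 0 -> ray a x) -> 0 < pairing u c.
Proof.
move=> aE uC ua; rewrite lt0r uC ?andbT //; apply/eqP => uc.
have u0 := c_interior uC uc; have [t t0 ct] := ua _ Cc uc.
have := qc; rewrite ct pairingZr (positive_gens_pairing aE) mulr1 => t00.
by move/eqP: cn0; apply; rewrite ct t00 scale0r.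
Qed.

Lemma above_vertex a (t : rat) : a \in E0 -> C (a + t *: c) -> 0 <= t.
Proof.
move=> aE Cat; have [u uC [ua uray _]] := positive_gens_exposed C_cone C_pointed s_irr aE.
have uc := exposed_interior_gt0 aE uC uray.
by have := uC _ Cat; rewrite !pairingE ua add0r pmulr_lge0.
Qed.

Lemma transverse_inj a b : a \in E0 -> b \in E0 -> pairing p a = pairing p b -> a = b.
Proof.
move=> aE bE pab; have [|t ab] := coord _ pab.
  by rewrite !(positive_gens_pairing (s := s)).
have t0 : 0 <= t by apply: (above_vertex bE); rewrite -ab; exact: positive_gens_cone aE.
have t0' : 0 <= - t.
  by apply: (above_vertex aE); rewrite ab scaleNr addrK; exact: positive_gens_cone bE.
have t00 : t = 0 by lra.
by rewrite ab t00 scale0r addr0.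
Qed.

(** [l] and [r] are the barycentric weights of the abscissa of [b]. The functional exposing [b] is
    zero at [b], positive at [a] and nonnegative at [d], so it shows that the chord passes strictly
    above [b]. *)
Lemma chord_above a b d : a \in E0 -> b \in E0 -> d \in E0 ->
  pairing p a < pairing p b -> pairing p b < pairing p d ->
  exists l r t, [/\ 0 < l, 0 < r, 0 < t & l *: a + r *: d = b + t *: c].
Proof.
move=> aE bE dE ab bd.
pose w := pairing p d - pairing p a; have w0 : 0 < w by rewrite /w; lra.
pose l := (pairing p d - pairing p b) / w; pose r := (pairing p b - pairing p a) / w.
have l0 : 0 < l by rewrite divr_gt0 //; lra.
have r0 : 0 < r by rewrite divr_gt0 //; lra.
have lr : l + r = 1.
  by rewrite -mulrDl -[RHS](mulfV (x := w)) ?gt_eqF //; congr (_ / _); rewrite /w; ring.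
have Ca := positive_gens_cone C_cone aE; have Cd := positive_gens_cone C_cone dE.
have [||t e] := @coord (l *: a + r *: d) b.
- by rewrite !pairingE !(positive_gens_pairing (s := s)) // !mulr1.
- rewrite !pairingE /l /r /w; field; rewrite gt_eqF //; exact: w0.
exists l, r, t; split=> //.
have [u uC [ub uray [v hv us]]] := positive_gens_exposed C_cone C_pointed s_irr bE.
have uc := exposed_interior_gt0 bE uC uray.
have := congr1 (pairing u) e; rewrite !pairingE ub add0r => ut.
rewrite -(pmulr_lgt0 _ uc) -ut; apply: ltr_wpDr.
  by rewrite mulr_ge0 ?uC ?ltW.
rewrite mulr_gt0 // lt0r uC // andbT; apply/eqP => ua.
have [k _ ak] := uray _ Ca ua.
have := positive_gens_pairing aE; rewrite ak pairingZr (positive_gens_pairing bE) mulr1.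
by move=> k1; move: ab; rewrite ak k1 scale1r ltxx.
Qed.

(** The functional is the height above the line through the neighbouring vertices [a] and [b]: [k]
    measures height along [c], and multiples of [p] and [q] correct it to vanish at both. *)
Lemma supporting_line a b : a \in E0 -> b \in E0 -> pairing p a < pairing p b ->
  (forall w, w \in E0 -> pairing p w <= pairing p a \/ pairing p b <= pairing p w) ->
  exists u, [/\ forall v, v \in s -> 0 <= pairing u v, u != 0,
    pairing u a = 0 & pairing u b = 0].
Proof.
move=> aE bE ab gap.
have qa := positive_gens_pairing aE; have qb := positive_gens_pairing bE.
have Ca := positive_gens_cone C_cone aE; have Cb := positive_gens_cone C_cone bE.
have [k kc] : exists k : 'rV[rat]_3, pairing k c = 1.
  have : exists i, c i 0 != 0.
    apply/existsP; apply: contra_neqT cn0 => /existsPn c0.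
    by apply/colP => i; rewrite mxE; apply/eqP; move: (c0 i); rewrite negbK.
  case=> i ci; exists ((c i 0)^-1 *: delta_mx 0 i).
  by rewrite pairingZl /pairing -rowE mxE mulVf.
pose sl := (pairing k b - pairing k a) / (pairing p b - pairing p a).
pose u := k - sl *: p + (sl * pairing p a - pairing k a) *: q.
have uc : pairing u c = 1 by rewrite !pairingE kc pc qc !mulr0 subr0 addr0.
have ua : pairing u a = 0 by rewrite !pairingE qa; ring.
have ub : pairing u b = 0.
  by rewrite !pairingE qb /sl; field; rewrite subr_eq0 gt_eqF.
(* Directions of height 0. If [z] points left, a suitable multiple carries [b] above [a]; if right,
   it carries [a] above [b]; if [z] is vertical, it lifts [a]. In each case the height gained is
   nonnegative. *)
clearbody u; have u0 z : C z -> pairing q z = 0 -> 0 <= pairing u z.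
  move=> Cz qz; have [pz|pz|pz] := ltrgtP (pairing p z) 0.
  - pose r := (pairing p b - pairing p a) / - pairing p z.
    have r0 : 0 <= r by rewrite divr_ge0 //; lra.
    have [||t e] := @coord (b + r *: z) a.
    + by rewrite !pairingE qa qb qz mulr0 addr0.
    + by rewrite !pairingE /r; field; rewrite lt_eqF.
    have t0 : 0 <= t by apply: (above_vertex aE); rewrite -e; apply: CD => //; exact: CZ.
    have := congr1 (pairing u) e; rewrite !pairingE ua ub uc !add0r mulr1 => et.
    by rewrite -(pmulr_rge0 (x := r)) ?et // divr_gt0 //; lra.
  - pose r := (pairing p b - pairing p a) / pairing p z.
    have r0 : 0 <= r by rewrite divr_ge0 //; lra.
    have [||t e] := @coord (a + r *: z) b.
    + by rewrite !pairingE qa qb qz mulr0 addr0.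
    + by rewrite !pairingE /r; field; rewrite gt_eqF.
    have t0 : 0 <= t by apply: (above_vertex bE); rewrite -e; apply: CD => //; exact: CZ.
    have := congr1 (pairing u) e; rewrite !pairingE ua ub uc !add0r mulr1 => et.
    by rewrite -(pmulr_rge0 (x := r)) ?et // divr_gt0 //; lra.
  - have [||t e] := @coord (a + z) a.
    + by rewrite !pairingE qz addr0.
    + by rewrite !pairingE pz addr0.
    have t0 : 0 <= t by apply: (above_vertex aE); rewrite -e; exact: CD.
    by have := congr1 (pairing u) e; rewrite !pairingE ua uc !add0r mulr1 => ->.
exists u; split=> //; last by apply: contra_eq_neq uc => ->; rewrite pairing0l eq_sym oner_eq0.
move=> v vs; have Cv := generator_mem C_cone vs.
(* A generator of negative height is brought to height 0 by adding a multiple of [a], where [u]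
   vanishes. One of positive height gives a vertex outside the gap; were it below the line, [a] or
   [b] would lie above a chord. *)
have [qv|qv|qv] := ltrgtP (pairing q v) 0; last exact: u0.
  have := u0 (v + (- pairing q v) *: a); rewrite !pairingE ua qa mulr0 addr0; apply.
    by apply: CD => //; apply: CZ => //; rewrite oppr_ge0 ltW.
  by rewrite mulr1 subrr.
have wE := mem_positive_gens vs qv; set w := _ *: v in wE.
suff : 0 <= pairing u w by rewrite pairingZr pmulr_rge0 ?invr_gt0.
have [pw|pw] := gap _ wE.
  move: pw; rewrite le_eqVlt => /orP[/eqP pw|pw].
    by rewrite (transverse_inj wE aE pw) ua.
  have [l [r [t [l0 r0 t0 e]]]] := chord_above wE aE bE pw ab.
  have := congr1 (pairing u) e; rewrite !pairingE ua ub uc mulr0 mulr1 addr0 add0r => et.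
  by rewrite -(pmulr_rge0 _ l0) et ltW.
move: pw; rewrite le_eqVlt => /orP[/eqP pw|pw].
  by rewrite -(transverse_inj bE wE pw) ub.
have [l [r [t [l0 r0 t0 e]]]] := chord_above aE bE wE ab pw.
have := congr1 (pairing u) e; rewrite !pairingE ua ub uc mulr0 mulr1 !add0r => et.
by rewrite -(pmulr_rge0 _ r0) et ltW.
Qed.

End Dim3.

Theorem positive_edge_chain (C : set 'cV[rat]_3) (chi : 'rV[int]_3) :
  polyhedral_cone C -> pointed C -> cone_dim C 3 -> changes_sign C chi ->
  lattice_crossings C chi ->
  exists a, edge_chain (dual_lattice_pred C) chi (num_positive_edges C chi) a.
Proof.
move=> /polyhedral_cone_seq[s0 Cs0] Cp Cfull Csign Clat.
have [s [ss irr]] := irredundant_generators s0.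
have {s0 Cs0 ss}Cs x : C x <-> cone s x by rewrite Cs0 ss.
have [p [c [Cc qc pc cint [c0 coord]]]] := chain_setup Cs Cp irr Cfull Csign.
set q := ratmx chi in Cc qc pc cint c0 coord *.
pose E := sort (fun x y => pairing p x <= pairing p y) (positive_gens s q).
have eE : num_positive_edges C chi = size E.
  by rewrite size_sort; exact: num_positive_edgesE.
(* The vertices have integral coordinates by [lattice_crossings], so taking numerators changes
   nothing. *)
rewrite eE; pose a j : 'cV[int]_3 := map_mx numq (nth 0 E j); exists a.
have EE j : (j < size E)%N -> nth 0 E j \in positive_gens s q.
  by move=> je; rewrite -(mem_sort (fun x y => pairing p x <= pairing p y)) mem_nth.
have aE j : (j < size E)%N -> ratmx (a j) = nth 0 E j.
  move=> je; have [v vs rv] := positive_gens_ray (EE j je).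
  have [|||w ew] := Clat (ray (nth 0 E j)) (nth 0 E j).
  - by rewrite rv; exact: ray_edge Cs Cp irr _ vs.
  - exact: ray_self.
  - by left; exact: positive_gens_pairing (EE j je).
  rewrite /a ew /ratmx; congr map_mx; apply/matrixP => i k; rewrite !mxE; exact: numq_int.
have pE m j : (j < size E)%N -> (ipair m (a j))%:~R = pairing (ratmx m) (nth 0 E j).
  by move=> je; rewrite -aE // pairing_ratmx.
have Euniq : uniq E by rewrite sort_uniq positive_gens_uniq.
have lt_p i j : (i < j)%N -> (j < size E)%N ->
    pairing p (nth 0 E i) < pairing p (nth 0 E j).
  move=> ij je; have ie := ltn_trans ij je.
  have := sorted_ltn_nth (leT := fun x y => pairing p x <= pairing p y)
    (fun y x z => @le_trans _ _ _ _ _) 0 (sort_sorted (fun x y => le_total _ _) _) _ _ ie je ij.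
  rewrite le_eqVlt => /orP[/eqP eqp|//].
  have /eqP := transverse_inj Cs Cp irr Cc qc cint c0 coord (EE i ie) (EE j je) eqp.
  by rewrite nth_uniq // ltn_eqF.
have mc m : dual_lattice_pred C m -> 0 <= pairing (ratmx m) c.
  by move=> /asboolP; apply.
have a_ge0 m j : dual_lattice_pred C m -> (j < size E)%N -> 0 <= ipair m (a j).
  move=> /asboolP Sm je; rewrite -(ler0z rat) pE //.
  exact/Sm/(positive_gens_cone Cs (EE j je)).
have height j : (j < size E)%N -> ipair chi (a j) = 1.
  by move=> je; apply/eqP; rewrite -(eqr_int rat) pE // (positive_gens_pairing (EE j je)).
split=> //.
(* Subtracting chi can only fail on generators of positive height. There the pairing with the vertex
   is a positive integer, hence at least the value 1 of chi. *)
- move=> m Sm; split=> [Smc j je|am].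
    have := a_ge0 _ _ Smc je; rewrite ipairDl ipairNl height //.
    by case: eqP => // ->.
  apply/(dual_latticeP Cs) => v vs; rewrite ratmxD ratmxN pairingDl pairingNl -/q.
  have mv : 0 <= pairing (ratmx m) v by move/(dual_latticeP Cs): Sm; apply.
  have [qv|qv] := lerP (pairing q v) 0; first by lra.
  have wE := mem_positive_gens vs qv; set w := _ *: v in wE.
  have vw : v = pairing q v *: w by rewrite scalerA mulfV ?scale1r // gt_eqF.
  have wE' : w \in E by rewrite mem_sort.
  have je : (index w E < size E)%N by rewrite index_mem.
  have : 1 <= ipair m (a (index w E)) by rewrite -gtz0_ge1 lt0r am // a_ge0.
  rewrite -(ler1z rat) pE // nth_index // => mw.
  have -> : pairing (ratmx m) v = pairing q v * pairing (ratmx m) w.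
    by rewrite {1}vw pairingZr.
  by rewrite subr_ge0 ler_peMr // ltW.
- move=> m i j k; rewrite leq_eqVlt => /predU1P[->//|ij].
  rewrite leq_eqVlt => /predU1P[->//|jk] ke Sm.
  have je := ltn_trans jk ke; have ie := ltn_trans ij je.
  move=> /eqP; rewrite -(intr_eq0 rat) pE // => /eqP mi.
  move=> /eqP; rewrite -(intr_eq0 rat) pE // => /eqP mk.
  (* Pairing the chord identity with [m] writes 0 as the sum of two nonnegative terms, one of them
     the value at the middle vertex. *)
  have [l [r [t [l0 r0 t0 e]]]] := chord_above Cs Cp irr Cc qc cint c0 coord
    (EE i ie) (EE j je) (EE k ke) (lt_p _ _ ij je) (lt_p _ _ jk ke).
  have := congr1 (pairing (ratmx m)) e; rewrite !pairingE mi mk !mulr0 addr0.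
  have := mulr_ge0 (ltW t0) (mc _ Sm); have := a_ge0 _ _ Sm je.
  rewrite -(ler0z rat) pE // => h1 h2 h3.
  apply/eqP; rewrite -(intr_eq0 rat) pE //.
  by move/esym/eqP: h3; rewrite paddr_eq0 // => /andP[].
- move=> j je; have je' := ltnW je.
  have [|u [us un0 ua ub]] := supporting_line Cs Cp irr Cc qc pc cint c0 coord
    (EE j je') (EE j.+1 je) (lt_p _ _ (ltnSn j) je).
    move=> w wE; have wE' : w \in E by rewrite mem_sort.
    have ie : (index w E < size E)%N by rewrite index_mem.
    rewrite -(nth_index 0 wE').
    have [ij|] := leqP (index w E) j.
      left; move: ij; rewrite leq_eqVlt => /predU1P[->//|ij]; exact/ltW/lt_p.
    rewrite leq_eqVlt => /predU1P[<-|ij]; first by right.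
    by right; exact/ltW/lt_p.
  have [k [m [k0 mk Sm]]] := dual_lattice_scale Cs us; exists m; split=> //.
  + apply: contra_neq un0 => m0; move: mk; rewrite m0 /ratmx map_mx0 => /esym/eqP.
    by rewrite scaler_eq0 pnatr_eq0 (gtn_eqF k0) => /eqP.
  + by apply/eqP; rewrite -(intr_eq0 rat) pE // mk pairingZl ua mulr0.
  + by apply/eqP; rewrite -(intr_eq0 rat) pE // mk pairingZl ub mulr0.
- move=> j je; have [u uC [ua uray _]] := positive_gens_exposed Cs Cp irr (EE j je).
  have [|k [m [k0 mk Sm]]] := dual_lattice_scale Cs (u := u).
    by move=> v vs; exact/uC/(generator_mem Cs).
  exists m; split=> //.
    by apply/eqP; rewrite -(intr_eq0 rat) pE // mk pairingZl ua mulr0.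
  move=> i ie ij; rewrite lt0r a_ge0 // andbT -(intr_eq0 rat) pE // mk pairingZl.
  rewrite mulf_eq0 pnatr_eq0 (gtn_eqF k0) /=; apply/eqP => ui.
  have [t _ et] := uray _ (positive_gens_cone Cs (EE i ie)) ui.
  have := positive_gens_pairing (EE i ie).
  rewrite et pairingZr (positive_gens_pairing (EE j je)) mulr1 => t1.
  by move/eqP: et; rewrite t1 scale1r nth_uniq // (negPf ij).
- move=> m j je maj.
  have [u uC [ua uray [v [t _ vt] us]]] := positive_gens_exposed Cs Cp irr (EE j je).
  have [|k [u' [k0 u'k Su']]] := dual_lattice_scale Cs (u := u).
    by move=> w ws; exact/uC/(generator_mem Cs).
  have u'a : ipair u' (a j) = 0.
    by apply/eqP; rewrite -(intr_eq0 rat) pE // u'k pairingZl ua mulr0.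
  (* [v] is left out of the shift: on it [u'] vanishes, but so does [m]. *)
  have [|N hN] := @archimedean_shift _ (rem v s) (ratmx u') (ratmx m).
    by move=> w ws; rewrite u'k pairingZl mulr_gt0 ?ltr0n ?us.
  exists (u' *+ N + m), (u' *+ N); split; last by rewrite addrAC subrr add0r.
  + apply/(dual_latticeP Cs) => w ws; rewrite ratmxD ratmxMn pairingDl pairingZl.
    have [->|wv] := eqVneq w v; last by apply: hN; rewrite rem_mem.
    by rewrite vt !pairingZr -!pE // u'a maj !mulr0 addr0.
  + apply/(dual_latticeP Cs) => w ws; rewrite ratmxMn pairingZl mulr_ge0 //.
    by move/(dual_latticeP Cs): Su'; apply.
  + by rewrite ipairDl ipairMn u'a maj mul0rn.
  + by rewrite ipairMn u'a mul0rn.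
Qed.

(** * Polynomials and relations *)

(* In type positions [monalg] would take over this notation. *)
Local Notation "{ 'mpoly' T [ n ] }" := (mpoly.mpoly n T) : type_scope.

(** * Linear maps given on monomials *)

Section MonomialExtension.
Variables (K : fieldType) (n : nat) (V : lmodType K).
Implicit Types (a : 'X_{1..n}) (p q : {mpoly K[n]}) (k : 'X_{1..n} -> V).

Definition lext k p : V := \sum_(a <- msupp p) p@_a *: k a.

Lemma lextw k p N : (msize p <= N)%N ->
  lext k p = \sum_(a : 'X_{1..n < N}) p@_a *: k a.
Proof.
move=> pN; rewrite /lext (ssrcomplements.big_mksub 'X_{1..n < N}) //=; first last.
- by move=> a /msize_mdeg_lt /leq_trans; apply.
- exact: msupp_uniq.
by rewrite big_rmcond //= => a /memN_msupp_eq0 ->; rewrite scale0r.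
Qed.

Lemma lext_is_linear k : linear (lext k).
Proof.
move=> c p q; pose N := maxn (msize (c *: p + q)) (maxn (msize p) (msize q)).
rewrite !(@lextw _ _ N) ?leq_max ?leqnn ?orbT //.
rewrite scaler_sumr -big_split /=; apply: eq_bigr => a _.
by rewrite mcoeffD mcoeffZ scalerDl scalerA.
Qed.

HB.instance Definition _ k :=
  GRing.isLinear.Build K {mpoly K[n]} V _ (lext k) (lext_is_linear k).

Lemma lextZr c k p : lext k (c *: p) = c *: lext k p.
Proof. exact: linearZZ. Qed.

Lemma lextX k a : lext k 'X_[a] = k a.
Proof. by rewrite /lext msuppX big_seq1 mcoeffX eqxx scale1r. Qed.

Lemma eq_lext k k' p : (forall a, k a = k' a) -> lext k p = lext k' p.
Proof. by move=> kk'; apply: eq_bigr => a _; rewrite kk'. Qed.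

Lemma lextD k k' p : lext (fun a => k a + k' a) p = lext k p + lext k' p.
Proof. by rewrite /lext -big_split; apply: eq_bigr => a _; rewrite scalerDr. Qed.

Lemma lextZ c k p : lext (fun a => c *: k a) p = c *: lext k p.
Proof. by rewrite /lext scaler_sumr; apply: eq_bigr => a _; rewrite !scalerA mulrC. Qed.

Lemma mpoly_linear_ind (Q : {mpoly K[n]} -> Prop) : Q 0 ->
  (forall p q, Q p -> Q q -> Q (p + q)) -> (forall c a, Q (c *: 'X_[a])) ->
  forall p, Q p.
Proof. by move=> Q0 QD QX; elim/mpolyind => // c a p _ _ Qp; exact: QD. Qed.

Lemma lext_mulX k a p : lext k ('X_[a] * p) = lext (fun b => k (a + b)%MM) p.
Proof.
elim/mpoly_linear_ind: p => [|p q hp hq|c b]; first by rewrite mulr0 !linear0.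
  by rewrite mulrDr !linearD /= hp hq.
by rewrite -scalerAr !linearZ /= -mpolyXD !lextX.
Qed.

Lemma lext0 k p : (forall a, k a = 0) -> lext k p = 0.
Proof. by move=> k0; rewrite /lext big1 // => a _; rewrite k0 scaler0. Qed.

End MonomialExtension.

Lemma lext_mull (K : fieldType) n (A : comAlgType K) (u : A) (k : 'X_{1..n} -> A) p :
  lext (fun a => u * k a) p = u * lext k p.
Proof. by rewrite /lext mulr_sumr; apply: eq_bigr => a _; rewrite scalerAr. Qed.

(** * Linear forms with values in K *)

Section LinearForms.
Variables (K : numFieldType) (d : nat).
Implicit Types (m : 'rV[int]_d) (l : 'cV[K]_d).

Definition linval (l : 'cV[K]_d) m : K := \sum_(j < d) (m 0 j)%:~R * l j 0.

Lemma linvalD l m1 m2 : linval l (m1 + m2) = linval l m1 + linval l m2.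
Proof. by rewrite -big_split; apply: eq_bigr => j _; rewrite mxE intrD mulrDl. Qed.

Lemma linval0 l : linval l 0 = 0.
Proof. by rewrite /linval big1 // => j _; rewrite mxE mul0r. Qed.

Lemma linvalN l m : linval l (- m) = - linval l m.
Proof. by apply/eqP; rewrite -addr_eq0 -linvalD addNr linval0. Qed.

Lemma linvalMn l m k : linval l (m *+ k) = linval l m *+ k.
Proof. by elim: k => [|k IH]; rewrite ?mulr0n ?linval0 // !mulrS linvalD IH. Qed.

Lemma linval_subl l1 l2 m : linval (l1 - l2) m = linval l1 m - linval l2 m.
Proof. by rewrite -sumrB; apply: eq_bigr => j _; rewrite !mxE mulrBr. Qed.

Lemma linval_intr (v : 'cV[int]_d) m : linval (map_mx intr v) m = (ipair m v)%:~R.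
Proof.
rewrite /ipair mxE rmorph_sum; apply: eq_bigr => j _.
by rewrite mxE rmorphM.
Qed.

Lemma additive_row_delta (g : 'rV[int]_d -> K) :
  (forall z z', g (z + z') = g z + g z') ->
  forall z, g z = \sum_(i < d) (z 0 i)%:~R * g (delta_mx 0 i).
Proof.
move=> gD; have g0 : g 0 = 0 by apply: (addrI (g 0)); rewrite -gD !addr0.
have gN z : g (- z) = - g z by apply/eqP; rewrite -addr_eq0 -gD addNr g0.
have gMn k z : g (k%:Z *: z) = k%:R * g z.
  elim: k => [|k IH]; first by rewrite scale0r g0 mul0r.
  by rewrite intS scalerDl scale1r gD IH -[in RHS]natr1 addrC mulrDl mul1r.
have gZ (k : int) z : g (k *: z) = k%:~R * g z.
  by case: k => k; rewrite ?gMn // NegzE scaleNr gN gMn rmorphN mulNr.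
move=> z; rewrite {1}[z]row_sum_delta (big_morph g gD g0).
by apply: eq_bigr => i _; rewrite gZ.
Qed.

End LinearForms.

(** Positive and negative parts turn an integral vector into a pair of monomial exponents. *)
Definition posn (z : int) : nat := if z is Posz k then k else 0.
Definition negn (z : int) : nat := if z is Negz k then k.+1 else 0.

Lemma posn_negn z : (posn z)%:Z - (negn z)%:Z = z.
Proof. by case: z => k /=; rewrite ?subr0 // NegzE sub0r. Qed.

Lemma posn_negnD (y z : int) :
  (posn (y + z) + (negn y + negn z) = posn y + posn z + negn (y + z))%N.
Proof. have := posn_negn y; have := posn_negn z; have := posn_negn (y + z); lia. Qed.

Lemma posn_negnB (k l : nat) :
  (posn (k%:Z - l%:Z) + l = negn (k%:Z - l%:Z) + k)%N.
Proof. have := posn_negn (k%:Z - l%:Z); lia. Qed.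

(** * Evaluation at the generators and homomorphisms on relations *)

Section EvalGens.
Variables (K : fieldType) (A : comAlgType K) (n : nat) (x : 'I_n -> A).
Implicit Types p q : {mpoly K[n]}.
Local Notation ev := (eval_gens x).

Lemma eval_gensD p q : ev (p + q) = ev p + ev q. Proof. exact: raddfD. Qed.
Lemma eval_gensM p q : ev (p * q) = ev p * ev q. Proof. exact: rmorphM. Qed.
Lemma eval_gens0 : ev 0 = 0. Proof. exact: raddf0. Qed.
Lemma eval_gens_sum I (r : seq I) (F : I -> {mpoly K[n]}) :
  ev (\sum_(i <- r) F i) = \sum_(i <- r) ev (F i).
Proof. exact: raddf_sum. Qed.
Lemma eval_gensZ c p : ev (c *: p) = c *: ev p.
Proof. by rewrite /eval_gens mmapZ /= -scalerAl mul1r. Qed.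
Lemma eval_gensX (a : 'X_{1..n}) : ev 'X_[a] = \prod_(i < n) x i ^+ a i.
Proof. by rewrite /eval_gens mmapX. Qed.
Lemma eval_gensU i : ev 'X_i = x i.
Proof. by rewrite /eval_gens mmapX mmap1U. Qed.

Lemma relation_idealD p q :
  relation_ideal x p -> relation_ideal x q -> relation_ideal x (p + q).
Proof. by rewrite /relation_ideal /= eval_gensD => -> ->; rewrite addr0. Qed.

Lemma relation_idealM p q : relation_ideal x q -> relation_ideal x (p * q).
Proof. by rewrite /relation_ideal /= eval_gensM => ->; rewrite mulr0. Qed.

Lemma relation_idealZ c p : relation_ideal x p -> relation_ideal x (c *: p).
Proof. by rewrite /relation_ideal /= eval_gensZ => ->; rewrite scaler0. Qed.

Lemma relation_ideal0 : relation_ideal x 0.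
Proof. exact: eval_gens0. Qed.

Lemma relation_ideal_sum I (r : seq I) (F : I -> {mpoly K[n]}) :
  (forall i, relation_ideal x (F i)) -> relation_ideal x (\sum_(i <- r) F i).
Proof. by move=> xF; apply: big_ind => //; [exact: relation_ideal0 | exact: relation_idealD]. Qed.

Section AdditiveOnRelations.
Variable f : {mpoly K[n]} -> A.
Hypothesis fD : forall p q, relation_ideal x p -> relation_ideal x q ->
  f (p + q) = f p + f q.
Hypothesis fM : forall p q, relation_ideal x q -> f (p * q) = ev p * f q.

Lemma conormal_hom0 : f 0 = 0.
Proof. by rewrite -(mulr0 0) fM ?eval_gens0 ?mul0r //; exact: relation_ideal0. Qed.

Lemma conormal_homZ c p : relation_ideal x p -> f (c *: p) = c *: f p.
Proof.
move=> xp; rewrite -mul_mpolyC fM // -[c%:MP]mulr1 mul_mpolyC eval_gensZ.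
by rewrite /eval_gens rmorph1 -scalerAl mul1r.
Qed.

Lemma conormal_hom_sum I (r : seq I) (F : I -> {mpoly K[n]}) :
  (forall i, relation_ideal x (F i)) ->
  f (\sum_(i <- r) F i) = \sum_(i <- r) f (F i).
Proof.
move=> xF; elim: r => [|i r IH]; first by rewrite !big_nil conormal_hom0.
by rewrite !big_cons fD ?IH //; exact: relation_ideal_sum.
Qed.

(* Vanishing on the square of the ideal is automatic. *)
Lemma conormal_hom_intro : conormal_hom x f.
Proof.
split=> // p [k [u [v [uv ->]]]]; rewrite conormal_hom_sum.
  by apply: big1 => i _; have [ui vi] := uv i; rewrite fM // ui mul0r.
by move=> i; apply: relation_idealM; have [] := uv i.
Qed.

End AdditiveOnRelations.

Lemma conormal_hom_der (h : 'I_n -> {mpoly K[n]}) :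
  conormal_hom x (fun p => ev (\sum_i h i * p^`M(i))).
Proof.
apply: conormal_hom_intro => [p q _ _|p q xq].
  by rewrite -eval_gensD -big_split; congr eval_gens; apply: eq_bigr => i _; rewrite mderivD mulrDr.
rewrite -eval_gensM mulr_sumr !eval_gens_sum; apply: eq_bigr => i _.
rewrite mderivM !eval_gensM eval_gensD !eval_gensM (_ : ev q = 0) // mulr0 add0r.
by rewrite mulrCA.
Qed.

Lemma conormal_homD f g : conormal_hom x f -> conormal_hom x g ->
  conormal_hom x (fun p => f p + g p).
Proof.
move=> [fD fM _] [gD gM _]; apply: conormal_hom_intro => [p q xp xq|p q xq].
  by rewrite fD // gD // addrACA.
by rewrite fM // gM // mulrDr.
Qed.

End EvalGens.

(** * Degree -chi homomorphisms on the relations of a toric ring *)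

Section ToricCoefficients.
Variables (K : fieldType) (d : nat) (C : set 'cV[rat]_d).
Local Notation A := (toric_ring K C).
Local Notation S := (dual_lattice_pred C).
Implicit Types (m : 'rV[int]_d) (u v : A) (s : dual_monoid C).

Lemma dual_lattice0 : S 0. Proof. by have [] := dual_lattice_closed C. Qed.

Lemma dual_latticeD m1 m2 : S m1 -> S m2 -> S (m1 + m2).
Proof. by have [_] := dual_lattice_closed C; apply. Qed.

(** Defined for every [m], with value 0 off the monoid, so that a shifted degree such as m - chi
    needs no proof of membership. *)
Definition tcoef m u : K :=
  if insub m is Some s then monalg.mcoeff (s : dual_monoid C) u else 0.

Lemma tcoefE s u : tcoef (val s) u = monalg.mcoeff s u.
Proof. by rewrite /tcoef valK. Qed.

Lemma tcoef_out m u : ~~ S m -> tcoef m u = 0.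
Proof. by move=> Sm; rewrite /tcoef insubN. Qed.

Lemma tcoef_is_linear m : linear_for *%R (tcoef m).
Proof.
move=> c u v; rewrite /tcoef; case: insub => [s|]; last by rewrite mulr0 addr0.
by rewrite monalg.mcoeffD monalg.mcoeffZ.
Qed.

HB.instance Definition _ m :=
  GRing.isLinear.Build K A K *%R (tcoef m) (tcoef_is_linear m).

Lemma tcoefU m c s : tcoef m (monalg.mkmalgU s c : A) = c * (m == val s)%:R.
Proof.
rewrite /tcoef; case: insubP => [t _ <-|Sm].
  by rewrite monalg.mcoeffU (inj_eq val_inj) eq_sym mulr_natr.
suff /negPf-> : m != val s by rewrite mulr0.
by apply: contraNneq Sm => ->; exact: valP.
Qed.

Lemma tcoef_inj u v : (forall m, tcoef m u = tcoef m v) -> u = v.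
Proof. by move=> uv; apply/monalg.malgP => s; rewrite -!tcoefE. Qed.

Lemma toric_homogP m u :
  toric_homog m u <-> forall m', m' != m -> tcoef m' u = 0.
Proof.
split=> [hu m' m'm|hu s us]; last first.
  by apply/eqP; apply: contraNT us => sm; rewrite -tcoefE hu.
rewrite /tcoef; case: insubP => // s _ sm'; apply/eqP; apply: contraNT m'm.
by move=> /hu <-; rewrite sm'.
Qed.

Lemma tcoef_mulU m c s u :
  tcoef m ((monalg.mkmalgU s c : A) * u) = c * tcoef (m - val s) u.
Proof.
rewrite [u in LHS]monalg.monalgE [u in RHS]monalg.monalgE mulr_sumr !raddf_sum.
rewrite mulr_sumr; apply: eq_bigr => t _.
rewrite /= [X in tcoef m X]sga_mulUU !tcoefU mulrA; congr (_ * _%:R).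
by rewrite subr_eq addrC.
Qed.

(** The value 0 off the monoid truncates Laurent monomials to the ring. *)
Definition chr m : A :=
  if insub m is Some s then monalg.mkmalgU (s : dual_monoid C) 1 else 0.

Lemma tcoef_chr m m' : tcoef m (chr m') = ((m == m') && S m')%:R.
Proof.
rewrite /chr; case: insubP => [s -> <-|/negPf->]; last by rewrite raddf0 andbF.
by rewrite tcoefU mul1r andbT.
Qed.

Lemma chr_out m : ~~ S m -> chr m = 0.
Proof. by move=> Sm; rewrite /chr insubN. Qed.

Lemma tcoef_chrM m m' u : tcoef m (chr m' * u) = (S m')%:R * tcoef (m - m') u.
Proof.
rewrite /chr; case: insubP => [s -> <-|/negPf->]; last by rewrite mul0r raddf0 mul0r.
by rewrite tcoef_mulU.
Qed.

Lemma chrM m m' : S m -> S m' -> chr m * chr m' = chr (m + m').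
Proof.
move=> Sm Sm'; apply: tcoef_inj => r.
rewrite tcoef_chrM !tcoef_chr Sm Sm' dual_latticeD // mul1r !andbT.
by rewrite subr_eq addrC.
Qed.

Lemma chr0 : chr 0 = 1.
Proof.
apply: tcoef_inj => m; rewrite tcoef_chr dual_lattice0 andbT.
have -> : tcoef m (1 : A) = tcoef m (monalg.mkmalgU (0 : dual_monoid C) 1 : A) by [].
by rewrite tcoefU mul1r.
Qed.

End ToricCoefficients.

(* Throughout, A is an algebra graded by Z^d whose component of degree m is the
   line spanned by [chr m] for m in the monoid S and is 0 otherwise; [tcoef m]
   is the coordinate in degree m. *)
Section GradedPresentation.
Variables (K : numFieldType) (d n : nat) (A : comAlgType K).
Variables (S : pred 'rV[int]_d) (gr : 'rV[int]_d -> set A).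
Variables (tcoef : 'rV[int]_d -> A -> K) (chr : 'rV[int]_d -> A).
Hypothesis S0 : S 0.
Hypothesis SD : forall m1 m2, S m1 -> S m2 -> S (m1 + m2).
Hypothesis tcoef_linear : forall m, linear_for *%R (tcoef m).
Hypothesis tcoef_inj : forall u v, (forall m, tcoef m u = tcoef m v) -> u = v.
Hypothesis tcoef_out : forall m u, ~~ S m -> tcoef m u = 0.
Hypothesis tcoef_chr : forall m m', tcoef m (chr m') = ((m == m') && S m')%:R.
Hypothesis chrM : forall m m', S m -> S m' -> chr m * chr m' = chr (m + m').
Hypothesis tcoef_chrM : forall m m' u,
  tcoef m (chr m' * u) = (S m')%:R * tcoef (m - m') u.
Hypothesis chr0 : chr 0 = 1.
Hypothesis chr_out : forall m, ~~ S m -> chr m = 0.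
Hypothesis grP : forall m u, gr m u <-> forall m', m' != m -> tcoef m' u = 0.
Local Notation P := {mpoly K[n]}.
Variables (x : 'I_n -> A) (deg : 'I_n -> 'rV[int]_d).
Hypothesis x_homog : forall i, gr (deg i) (x i).
Implicit Types (a b c : 'X_{1..n}) (p q g : P) (m : 'rV[int]_d) (u v : A).
Local Notation ev := (eval_gens x).

Lemma tcoefD m u v : tcoef m (u + v) = tcoef m u + tcoef m v.
Proof. by have := tcoef_linear m 1 u v; rewrite scale1r mul1r. Qed.

Lemma tcoef0 m : tcoef m 0 = 0.
Proof. by apply: (addrI (tcoef m 0)); rewrite -tcoefD !addr0. Qed.

Lemma tcoefZ m (k : K) u : tcoef m (k *: u) = k * tcoef m u.
Proof. by have := tcoef_linear m k u 0; rewrite !addr0 tcoef0 addr0. Qed.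

Lemma tcoef_sum m I (r : seq I) (F : I -> A) :
  tcoef m (\sum_(i <- r) F i) = \sum_(i <- r) tcoef m (F i).
Proof. exact: (big_morph (tcoef m) (tcoefD m) (tcoef0 m)). Qed.

Lemma scale_chrM (c c' : K) m m' : S m -> S m' ->
  (c *: chr m) * (c' *: chr m') = (c * c') *: chr (m + m').
Proof. by move=> Sm Sm'; rewrite -scalerAl -scalerAr scalerA chrM. Qed.

Lemma SMn m k : S m -> S (m *+ k).
Proof.
move=> Sm; elim: k => [|k IH]; rewrite ?mulrS; [exact: S0 | exact: SD].
Qed.

(** A generator equal to 0 is homogeneous of every degree, so [deg i] carries information only when
    [lcoef i != 0]. *)
Definition lcoef i : K := tcoef (deg i) (x i).
Definition lcoefm a : K := \prod_(i < n) lcoef i ^+ a i.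
Definition degm a : 'rV[int]_d := \sum_(i < n) deg i *+ a i.

Lemma degmD a b : degm (a + b)%MM = degm a + degm b.
Proof. by rewrite -big_split; apply: eq_bigr => i _; rewrite mnmDE mulrnDr. Qed.

Lemma lcoefmD a b : lcoefm (a + b)%MM = lcoefm a * lcoefm b.
Proof. by rewrite -big_split; apply: eq_bigr => i _; rewrite mnmDE exprD. Qed.

Lemma degmU i : degm U_(i)%MM = deg i.
Proof.
rewrite /degm (bigD1 i) //= mnm1E eqxx big1 ?addr0 // => j ji.
by rewrite mnm1E eq_sym (negPf ji).
Qed.

Lemma lcoefmU i : lcoefm U_(i)%MM = lcoef i.
Proof.
rewrite /lcoefm (bigD1 i) //= mnm1E eqxx big1 ?mulr1 // => j ji.
by rewrite mnm1E eq_sym (negPf ji).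
Qed.

Lemma lcoefm_neq0 a : lcoefm a != 0 <-> forall i, a i != 0%N -> lcoef i != 0.
Proof.
rewrite prodf_seq_neq0; split=> [/allP h i ai|h].
  by have := h i (mem_index_enum i); rewrite expf_eq0 lt0n ai.
by apply/allP => i _ /=; rewrite expf_eq0 lt0n negb_and negbK; case: eqVneq => //= /h.
Qed.

Lemma lcoef_lattice i : lcoef i != 0 -> S (deg i).
Proof. by apply: contraNT => Si; rewrite /lcoef tcoef_out. Qed.

Lemma lcoefm_lattice a : lcoefm a != 0 -> S (degm a).
Proof.
move=> /lcoefm_neq0 ha; apply: (big_ind S); [exact: S0|exact: SD|].
move=> i _; have [->|/ha/lcoef_lattice Si] := eqVneq (a i) 0%N.
  by rewrite mulr0n; exact: S0.
by elim: (a i) => [|k IH]; rewrite ?mulrS; [exact: S0 | exact: SD].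
Qed.

Lemma gen_chr i : x i = lcoef i *: chr (deg i).
Proof.
apply: tcoef_inj => m; rewrite tcoefZ tcoef_chr.
have [->|mi] := eqVneq m (deg i); last first.
  by rewrite mulr0; apply/(grP _ _).1: mi; exact: x_homog.
case: (boolP (S (deg i))) => [_|Si]; first by rewrite mulr1.
by rewrite /lcoef tcoef_out // mul0r.
Qed.

Lemma gen_chrX i k : lcoef i != 0 -> x i ^+ k = lcoef i ^+ k *: chr (deg i *+ k).
Proof.
move=> /lcoef_lattice Si; elim: k => [|k IH].
  by rewrite !expr0 mulr0n chr0 scale1r.
by rewrite exprS IH gen_chr scale_chrM ?SMn // -exprS mulrS.
Qed.

Lemma ev_monomial a : ev 'X_[a] = lcoefm a *: chr (degm a).
Proof.
rewrite eval_gensX; have [a0|a0] := eqVneq (lcoefm a) 0.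
  have [i xai] : exists i, x i ^+ a i = 0.
    move/eqP: a0; rewrite prodf_seq_eq0 => /hasP[i _ /=].
    rewrite expf_eq0 => /andP[ai /eqP xi0]; exists i.
    by rewrite gen_chr xi0 scale0r expr0n gtn_eqF.
  by rewrite a0 scale0r (bigD1 i) //= xai mul0r.
move/lcoefm_neq0: a0 => a0; rewrite /lcoefm /degm.
suff [] : \prod_(i < n) x i ^+ a i =
    (\prod_(i < n) lcoef i ^+ a i) *: chr (\sum_(i < n) deg i *+ a i)
    /\ S (\sum_(i < n) deg i *+ a i) by [].
elim: (index_enum _) => [|i r [IH Sr]].
  by rewrite !big_nil scale1r chr0; split=> //; exact: S0.
have [ai|/a0 xi0] := eqVneq (a i) 0%N.
  by rewrite !big_cons IH ai !expr0 mulr0n !mul1r add0r.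
have Si := SMn (a i) (lcoef_lattice xi0).
rewrite !big_cons IH gen_chrX // scale_chrM //; split=> //.
exact: SD.
Qed.

Lemma ev_lext p : ev p = lext (fun a => lcoefm a *: chr (degm a)) p.
Proof.
elim/mpoly_linear_ind: p => [|p q hp hq|c a]; first by rewrite eval_gens0 linear0.
  by rewrite eval_gensD hp hq linearD.
by rewrite eval_gensZ ev_monomial lextZr lextX.
Qed.

(** In a relation the weighted coefficients of the monomials of any fixed degree add up to 0. Thus
    every contribution that depends on the degree alone disappears on relations. *)
Lemma relation_degree_sum (V : lmodType K) (y : 'rV[int]_d -> V) g :
  relation_ideal x g -> lext (fun a => lcoefm a *: y (degm a)) g = 0.
Proof.
move=> g0; have h m : \sum_(a <- msupp g) g@_a * lcoefm a * (m == degm a)%:R = 0.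
  have := congr1 (tcoef m) g0; rewrite ev_lext tcoef_sum tcoef0 => e.
  rewrite -[RHS]e; apply: eq_bigr => a _.
  rewrite !tcoefZ tcoef_chr !mulrA.
  have [->|/lcoefm_lattice ->] := eqVneq (lcoefm a) 0; first by rewrite !mulr0 !mul0r.
  by rewrite andbT.
pose r := undup (map degm (msupp g)).
transitivity (\sum_(m <- r) (\sum_(a <- msupp g) g@_a * lcoefm a * (m == degm a)%:R) *: y m).
  under eq_bigr do rewrite scaler_suml.
  rewrite exchange_big /= /lext big_seq [RHS]big_seq; apply: eq_bigr => a ag.
  rewrite (bigD1_seq (degm a)) ?undup_uniq ?mem_undup ?map_f //= eqxx mulr1.
  rewrite big1 ?addr0 ?scalerA // => m /negPf->; by rewrite mulr0 scale0r.
by rewrite big1 // => m _; rewrite h scale0r.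
Qed.

Hypothesis x_gen : forall u, exists p, ev p = u.

Lemma monomial_of_degree m : S m -> exists a, lcoefm a != 0 /\ degm a = m.
Proof.
move=> Sm; have [p pm] := x_gen (chr m).
apply: contrapT => na; have := congr1 (tcoef m) pm.
rewrite tcoef_chr eqxx Sm ev_lext tcoef_sum big1; first by move/eqP; rewrite eq_sym oner_eq0.
move=> a _; rewrite !tcoefZ tcoef_chr; have [->|a0] := eqVneq (lcoefm a) 0.
  by rewrite mul0r mulr0.
case: eqVneq => [ma|_]; last by rewrite !mulr0.
by case: na; exists a.
Qed.

(** * Homomorphisms given by a vector eta *)

Variable chi : 'rV[int]_d.
Implicit Types (eta : 'I_n -> K).

Definition mval eta a : K := \sum_(i < n) eta i *+ a i.

Lemma mvalD eta a b : mval eta (a + b)%MM = mval eta a + mval eta b.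
Proof. by rewrite -big_split; apply: eq_bigr => i _; rewrite mnmDE mulrnDr. Qed.

Lemma mvalB eta eta' a : mval (fun i => eta i - eta' i) a = mval eta a - mval eta' a.
Proof. by rewrite -sumrB; apply: eq_bigr => i _; rewrite mulrnBl. Qed.

Lemma mval_sum N (k : 'I_N -> K) (H : 'I_N -> 'I_n -> K) a :
  mval (fun i => \sum_j k j * H j i) a = \sum_j k j * mval (H j) a.
Proof.
rewrite /mval; under eq_bigr do rewrite -sumrMnl.
rewrite exchange_big; apply: eq_bigr => j _ /=; rewrite mulr_sumr.
by apply: eq_bigr => i _; rewrite mulrnAr.
Qed.

(* The map induced on the relation ideal by the derivation of the polynomial
   ring into K[Z^d] that sends x_i to eta_i x_i chi^(-chi). *)
Definition eta_hom eta p : A :=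
  lext (fun a => (lcoefm a * mval eta a) *: chr (degm a - chi)) p.

(* Those for which [eta_hom] takes its values on relations in A. *)
Definition admissible eta : Prop := forall a b,
  lcoefm a != 0 -> lcoefm b != 0 -> degm a = degm b -> ~~ S (degm a - chi) ->
  mval eta a = mval eta b.

(** By the product rule the new terms are those with [mval eta c], which depend on the degree only
    and cancel on a relation. The truncation in [chr (degm b - chi)] loses terms only when this
    degree is outside S; there [mval eta b] depends on the degree only, by admissibility, so these
    cancel too. *)
Lemma eta_hom_mulX eta c g : admissible eta -> relation_ideal x g ->
  eta_hom eta ('X_[c] * g) = ev 'X_[c] * eta_hom eta g.
Proof.
move=> adm xg; rewrite /eta_hom lext_mulX ev_monomial.
have [c0|c0] := eqVneq (lcoefm c) 0.
  by rewrite c0 scale0r mul0r lext0 // => b; rewrite lcoefmD c0 !mul0r scale0r.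
have Sc := lcoefm_lattice c0.
have /boolp.choice[kap hkap] : forall m, exists v : K, forall b, lcoefm b != 0 ->
    degm b = m -> ~~ S (m - chi) -> mval eta b = v.
  move=> m.
  have [[a [a0 am nSm]]|na] :=
      pselect (exists a, [/\ lcoefm a != 0, degm a = m & ~~ S (m - chi)]).
    by exists (mval eta a) => b b0 bm _; apply: adm => //; rewrite bm.
  by exists 0 => b b0 bm Sm; case: na; exists b.
pose y m := mval eta c *: chr (degm c + m - chi).
pose z m := if S (m - chi) then 0 else kap m *: chr (degm c + m - chi).
rewrite (eq_lext (k' := fun b => lcoefm c *: (lcoefm b *: y (degm b) +
  (lcoefm b *: z (degm b) +
   (chr (degm c) * ((lcoefm b * mval eta b) *: chr (degm b - chi))))))).
  rewrite lextZ !lextD !relation_degree_sum // !add0r lext_mull -scalerAl //.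
move=> b; rewrite lcoefmD degmD mvalD.
have [b0|b0] := eqVneq (lcoefm b) 0.
  by rewrite b0 mulr0 !mul0r !scale0r mulr0 !add0r scaler0.
rewrite /z; case: ifPn => [Sb|nSb].
  rewrite scaler0 add0r -scalerAr chrM // addrA /y !scalerA -scalerDl scalerA.
  by congr (_ *: _); ring.
rewrite (chr_out nSb) scaler0 mulr0 addr0 -(hkap _ b) // /y !scalerA -scalerDl scalerA.
by congr (_ *: _); ring.
Qed.

Lemma eta_hom_conormal eta : admissible eta -> conormal_hom x (eta_hom eta).
Proof.
move=> adm; apply: conormal_hom_intro => [p q _ _|p q xq]; first exact: linearD.
elim/mpoly_linear_ind: p => [|p p' hp hp'|c a].
- by rewrite mul0r eval_gens0 mul0r; exact: linear0.
- by rewrite mulrDl eval_gensD mulrDl -hp -hp'; exact: linearD.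
by rewrite -scalerAl eval_gensZ -scalerAl -eta_hom_mulX //; exact: lextZr.
Qed.

Lemma eta_hom_homog eta : admissible eta ->
  conormal_hom_homog gr x deg (- chi) (eta_hom eta).
Proof.
move=> adm; split=> [|m g _ gm]; first exact: eta_hom_conormal.
apply/grP => m' m'm; rewrite /eta_hom /lext tcoef_sum big_seq big1 // => a /gm am.
by rewrite !tcoefZ tcoef_chr /degm am (negPf m'm) !mulr0.
Qed.

Lemma eq_eta_hom eta eta' p :
  (forall i, lcoef i != 0 -> eta i = eta' i) -> eta_hom eta p = eta_hom eta' p.
Proof.
move=> ee'; apply: eq_lext => a; have [->|/lcoefm_neq0 a0] := eqVneq (lcoefm a) 0.
  by rewrite !mul0r.
congr ((_ * _) *: _); apply: eq_bigr => i _.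
by have [->|/a0/ee'->] := eqVneq (a i) 0%N.
Qed.

Lemma eta_homD eta eta' p :
  eta_hom (fun i => eta i + eta' i) p = eta_hom eta p + eta_hom eta' p.
Proof.
rewrite -lextD; apply: eq_lext => a; rewrite -scalerDl -mulrDr; congr ((_ * _) *: _).
by rewrite -big_split; apply: eq_bigr => i _; rewrite mulrnDl.
Qed.

Lemma eta_hom_sum e (k : 'I_e -> K) (H : 'I_e -> 'I_n -> K) p :
  eta_hom (fun i => \sum_j k j * H j i) p = \sum_j k j *: eta_hom (H j) p.
Proof.
rewrite /eta_hom /lext; under [RHS]eq_bigr do rewrite scaler_sumr.
rewrite exchange_big; apply: eq_bigr => a _ /=.
rewrite mval_sum mulr_sumr scaler_suml scaler_sumr; apply: eq_bigr => j _.
by rewrite !scalerA; congr (_ *: _); ring.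
Qed.

Lemma linval_degm l a : linval l (degm a) = mval (fun i => linval l (deg i)) a.
Proof.
rewrite /degm (big_morph _ (linvalD l) (linval0 l)).
by apply: eq_bigr => i _; rewrite linvalMn.
Qed.

Lemma eta_hom_linear l g : relation_ideal x g ->
  eta_hom (fun i => linval l (deg i)) g = 0.
Proof.
move=> xg; rewrite -[RHS](relation_degree_sum (fun m => linval l m *: chr (m - chi)) xg).
by apply: eq_lext => a; rewrite scalerA linval_degm.
Qed.

(** Under this condition each eta_i x_i chi^(-chi) lies in A and lifts to a polynomial. *)
Lemma eta_hom_der eta :
  (forall i, lcoef i != 0 -> eta i != 0 -> S (deg i - chi)) ->
  exists h : 'I_n -> P, forall p, eta_hom eta p = ev (\sum_i h i * p^`M(i)).
Proof.
move=> Seta.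
have /boolp.choice[h hh] : forall i, exists p,
    ev p = (lcoef i * eta i) *: chr (deg i - chi) by move=> i; exact: x_gen.
exists h => p; elim/mpoly_linear_ind: p => [|p q hp hq|c a].
- rewrite big1 ?eval_gens0; first exact: linear0.
  by move=> i _; rewrite mderiv0 mulr0.
- rewrite [LHS]linearD [X in X + _]hp [X in _ + X]hq -eval_gensD -big_split.
  by congr eval_gens; apply: eq_bigr => i _; rewrite mderivD mulrDr.
rewrite [LHS]lextZr lextX eval_gens_sum mulr_sumr scaler_suml scaler_sumr.
apply: eq_bigr => i _; rewrite mderivZ mderivX -!scalerAr !eval_gensZ eval_gensM hh ev_monomial.
congr (_ *: _); have [ai|ai] := eqVneq (a i) 0%N; first by rewrite ai mulr0n mulr0 !scale0r.
have ea : a = (U_(i) + (a - U_(i)))%MM.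
  apply/mnmP => j; rewrite mnmDE mnmBE mnm1E; case: eqVneq => [<-|_] /=.
    by rewrite subnKC // lt0n.
  by rewrite subn0.
rewrite {1 3}ea lcoefmD degmD lcoefmU degmU.
rewrite -scalerAl -scalerAr !scalerA.
have [->|i0] := eqVneq (lcoef i) 0; first by rewrite !(mul0r, mulr0) !scale0r.
have [->|e0] := eqVneq (eta i) 0; first by rewrite mul0rn !(mul0r, mulr0) !scale0r.
have [->|b0] := eqVneq (lcoefm (a - U_(i))%MM) 0; first by rewrite !(mul0r, mulr0) !scale0r.
rewrite chrM ?Seta ?lcoefm_lattice // addrAC; congr (_ *: _).
by rewrite -mulr_natl; ring.
Qed.

(** The coefficients are inverted so that both terms evaluate to the same character when the degrees
    agree. *)
Definition binom_rel a b : P := (lcoefm a)^-1 *: 'X_[a] - (lcoefm b)^-1 *: 'X_[b].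

Lemma binom_rel_ideal a b : lcoefm a != 0 -> lcoefm b != 0 -> degm a = degm b ->
  relation_ideal x (binom_rel a b).
Proof.
move=> a0 b0 ab; rewrite /relation_ideal /= /binom_rel -scaleNr eval_gensD !eval_gensZ.
by rewrite !ev_monomial !scalerA mulNr !mulVf // ab scaleN1r scale1r subrr.
Qed.

Lemma null_generator_ideal i : lcoef i = 0 -> relation_ideal x 'X_i.
Proof. by move=> i0; rewrite /relation_ideal /= eval_gensU gen_chr i0 scale0r. Qed.

(* The relation ideal is spanned by multiples of the generators that vanish
   in A and by binomials. *)
Lemma conormal_hom_eq f f' : conormal_hom x f -> conormal_hom x f' ->
  (forall a b, lcoefm a != 0 -> lcoefm b != 0 -> degm a = degm b ->
     f (binom_rel a b) = f' (binom_rel a b)) ->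
  (forall i, lcoef i = 0 -> f 'X_i = f' 'X_i) ->
  forall g, relation_ideal x g -> f g = f' g.
Proof.
move=> [fD fM _] [fD' fM' _] fbin fnull g xg.
have /boolp.choice[r hr] : forall m, exists b,
    (exists a, lcoefm a != 0 /\ degm a = m) -> lcoefm b != 0 /\ degm b = m.
  move=> m; have [[a ha]|na] := pselect (exists a, lcoefm a != 0 /\ degm a = m).
    by exists a.
  by exists 0%MM => ha.
have hr0 a : lcoefm a != 0 -> lcoefm (r (degm a)) != 0 /\ degm (r (degm a)) = degm a.
  by move=> a0; apply: hr; exists a.
(* [Y m] is a reference monomial, normalised to evaluate to [chr m]. Replacing each monomial of [g]
   by its difference [t a] with the reference changes nothing, as the subtracted terms depend on the
   degree only. *)
pose Y m : P := (lcoefm (r m))^-1 *: 'X_[r m].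
pose t a : P := 'X_[a] - lcoefm a *: Y (degm a).
have tE a : lcoefm a != 0 -> t a = lcoefm a *: binom_rel a (r (degm a)).
  by move=> a0; rewrite /t /binom_rel scalerBr [in RHS]scalerA mulfV // scale1r.
have t0E a : lcoefm a = 0 -> exists2 i, lcoef i = 0 & t a = 'X_[(a - U_(i))%MM] * 'X_i.
  move=> a0; have [i ai i0] : exists2 i, a i != 0%N & lcoef i = 0.
    move/eqP: a0; rewrite prodf_seq_eq0 => /hasP[i _ /=].
    by rewrite expf_eq0 lt0n => /andP[ai /eqP i0]; exists i.
  exists i => //; rewrite /t a0 scale0r subr0 -mpolyXD; congr 'X_[_].
  apply/mnmP => j; rewrite mnmDE mnmBE mnm1E; case: eqVneq => [<-|].
    by rewrite subnK // lt0n.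
  by rewrite subn0 addn0.
have xt a : relation_ideal x (t a).
  have [/t0E[i i0 ->]|a0] := eqVneq (lcoefm a) 0.
    by apply/relation_idealM/null_generator_ideal.
  rewrite tE //; have [r0 rm] := hr0 _ a0.
  exact/relation_idealZ/binom_rel_ideal.
have ft a : f (t a) = f' (t a).
  have [/t0E[i i0 ->]|a0] := eqVneq (lcoefm a) 0.
    have xi := null_generator_ideal i0.
    by rewrite fM // fM' // fnull.
  have [r0 rm] := hr0 _ a0; have xb : relation_ideal x (binom_rel a (r (degm a))).
    exact: binom_rel_ideal.
  by rewrite tE // (conormal_homZ fM) // (conormal_homZ fM') // fbin.
have -> : g = \sum_(a <- msupp g) g@_a *: t a.
  under eq_bigr do rewrite scalerBr.
  rewrite sumrB -mpolyE -[X in _ = _ - X]/(lext (fun a => lcoefm a *: Y (degm a)) g).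
  by rewrite relation_degree_sum // subr0.
have xgt a : relation_ideal x (g@_a *: t a) by exact: relation_idealZ.
rewrite (conormal_hom_sum fD fM) // (conormal_hom_sum fD' fM') //.
apply: eq_bigr => a _.
by rewrite (conormal_homZ fM) // (conormal_homZ fM') // ft.
Qed.

(* The relations between the degrees are spanned over K by integral ones, and an
   integral relation is the difference of two monomials of equal degree. *)
Lemma linear_of_relations (G : pred 'I_n) eta :
  (forall a b, (forall i, a i != 0%N -> G i) -> (forall i, b i != 0%N -> G i) ->
     degm a = degm b -> mval eta a = mval eta b) ->
  exists l : 'cV[K]_d, forall i, G i -> eta i = linval l (deg i).
Proof.
move=> rel.
pose D : 'M[rat]_(n, d) := \matrix_(i, j) if G i then (deg i 0 j)%:~R else 0.
pose E : 'cV[K]_n := \col_i if G i then eta i else 0.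
pose DK : 'M[K]_(n, d) := map_mx ratr D.
(* Linearity means that [E^T] is orthogonal to the columns of the cokernel, the relations between
   the degrees. Computed over the rationals, a column becomes integral after clearing denominators,
   and its two parts are the monomials [a] and [b]. *)
suff /submxP[l El] : (E^T <= DK^T)%MS.
  exists l^T => i Gi; have := congr1 (fun M : 'rV_n => M 0 i) El.
  rewrite !mxE Gi => ->; apply: eq_bigr => j _.
  by rewrite !mxE Gi ratr_int mulrC.
have -> : DK^T = map_mx ratr D^T by apply/matrixP => i j; rewrite !mxE.
rewrite submxE -map_cokermx; apply/eqP/rowP => j.
have Dc : D^T *m cokermx D^T = 0 by exact: mulmx_coker.
set c := cokermx D^T in Dc *; clearbody c; rewrite mxE [RHS]mxE.
have [k [z [k0 zk]]] := clear_denominators (col j c).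
have zE i : (z i 0)%:~R = k%:R * c i j :> rat.
  by have := congr1 (fun M : 'cV_n => M i 0) zk; rewrite !mxE.
have [a aE] : exists a : 'X_{1..n}, forall i, a i = if G i then posn (z i 0%R) else 0%N.
  by exists [multinom if G i then posn (z i 0%R) else 0%N | i < n] => i; rewrite mnmE.
have [b bE] : exists b : 'X_{1..n}, forall i, b i = if G i then negn (z i 0%R) else 0%N.
  by exists [multinom if G i then negn (z i 0%R) else 0%N | i < n] => i; rewrite mnmE.
have ab : degm a = degm b.
  apply/rowP => j'; apply/eqP; rewrite -subr_eq0 /degm !summxE -sumrB.
  rewrite -(intr_eq0 rat) rmorph_sum /=.
  suff -> : \sum_(i < n) ((deg i *+ a i) 0 j' - (deg i *+ b i) 0 j')%:~R =
      k%:R * (D^T *m c) j' j :> rat by rewrite Dc mxE mulr0.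
  rewrite mxE mulr_sumr; apply: eq_bigr => i _.
  rewrite !mulmxnE !mxE aE bE; case: ifP => Gi; last by rewrite !mulr0n subrr mul0r mulr0.
  rewrite mulrCA -zE -rmorphM; congr (_%:~R).
  rewrite -[_ *+ posn _]mulr_natr -[_ *+ negn _]mulr_natr !natz -mulrBr.
  by rewrite posn_negn.
have e : \sum_(i < n) (eta i *+ a i - eta i *+ b i) = 0.
  rewrite sumrB; apply/eqP; rewrite subr_eq0; apply/eqP.
  by apply: (rel a b) => // i; rewrite ?aE ?bE; case: (G i).
have k0' : k%:R != 0 :> K by rewrite pnatr_eq0 -lt0n.
apply: (mulfI k0'); rewrite mulr0 -[RHS]e mulr_sumr; apply: eq_bigr => i _.
rewrite !mxE aE bE; case: ifP => Gi; last by rewrite mul0r mulr0 !mulr0n subrr.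
have zK : k%:R * ratr (c i j) = (z i 0)%:~R :> K.
  by rewrite -[RHS](ratr_int K) zE rmorphM /= ratr_nat.
transitivity (eta i * (k%:R * ratr (c i j))); first exact: mulrCA.
by rewrite zK -[in LHS](posn_negn (z i 0)) rmorphB /= -!pmulrn mulrBr !mulr_natr.
Qed.

Lemma eta_hom_binom_rel eta a b : lcoefm a != 0 -> lcoefm b != 0 -> degm a = degm b ->
  eta_hom eta (binom_rel a b) = (mval eta a - mval eta b) *: chr (degm a - chi).
Proof.
move=> a0 b0 ab; rewrite /binom_rel -scaleNr [LHS]linearD [X in X + _]lextZr [X in _ + X]lextZr.
rewrite !lextX ab !scalerA mulNr !mulKf // -scalerDl //.
Qed.

(** * From homomorphisms of degree -chi to admissible vectors *)

Section ConormalToEta.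
Hypothesis S_gen : forall m, exists m1 m2, [/\ S m1, S m2 & m = m1 - m2].
Variable f : P -> A.
Hypothesis f_homog : conormal_hom_homog gr x deg (- chi) f.

Let phi a b := tcoef (degm a - chi) (f (binom_rel a b)).

Let rel a b := [/\ lcoefm a != 0, lcoefm b != 0 & degm a = degm b].

Let f_binom a b : rel a b -> f (binom_rel a b) = phi a b *: chr (degm a - chi).
Proof.
move=> [a0 b0 ab]; have [_ fh] := f_homog.
have /grP fh0 : gr (degm a - chi) (f (binom_rel a b)).
  apply: fh; first exact: binom_rel_ideal.
  move=> c; rewrite mcoeff_msupp /binom_rel mcoeffB !mcoeffZ !mcoeffX.
  have [<- _ //|_] := eqVneq a c; have [<- _ //|_] := eqVneq b c.
  by rewrite !mulr0 subrr eqxx.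
apply: tcoef_inj => m; rewrite tcoefZ tcoef_chr.
have [->|mm] := eqVneq m (degm a - chi); last by rewrite fh0 // mulr0.
case: (boolP (S _)) => [_|nS]; first by rewrite mulr1.
by rewrite tcoef_out // mulr0.
Qed.

Let phi_out a b : ~~ S (degm a - chi) -> phi a b = 0.
Proof. exact: tcoef_out. Qed.

Let phi_trans a b c : rel a b -> rel b c -> phi a b + phi b c = phi a c.
Proof.
move=> [a0 b0 ab] [_ c0 bc]; rewrite /phi ab bc -tcoefD; congr tcoef.
have [[fD _ _] _] := f_homog.
rewrite -fD; try by apply: binom_rel_ideal; rewrite ?ab.
by congr f; rewrite /binom_rel addrA subrK.
Qed.

(** Linearity of [f] over A, read off in one coefficient. If [degm a - chi] is outside S, then [f]
    is 0 on the binomial and both sides vanish. *)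
Let phi_shift a b c : rel a b -> lcoefm c != 0 -> phi (a + c)%MM (b + c)%MM = phi a b.
Proof.
move=> rab c0; have [a0 b0 ab] := rab; have [[_ fM _] _] := f_homog.
have Sc := lcoefm_lattice c0.
rewrite {1}/phi (_ : binom_rel (a + c)%MM (b + c)%MM =
    ((lcoefm c)^-1 *: 'X_[c]) * binom_rel a b); last first.
  rewrite /binom_rel mulrBr -!scalerAl -!scalerAr -!mpolyXD !scalerA !lcoefmD !invfM.
  by rewrite ![(c + _)%MM]addmC ![_ * (lcoefm c)^-1]mulrC.
rewrite fM; last exact: binom_rel_ideal.
rewrite f_binom // eval_gensZ ev_monomial scalerA mulVf // scale1r tcoef_chrM Sc mul1r.
rewrite degmD addrAC addrK tcoefZ tcoef_chr eqxx /=.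
by case: (boolP (S _)) => [_|nS]; rewrite ?mulr1 // phi_out ?mul0r.
Qed.

Let pp (z : 'rV[int]_n) : 'X_{1..n} :=
  [multinom if lcoef i == 0%R then 0%N else posn (z 0%R i) | i < n].
Let np (z : 'rV[int]_n) : 'X_{1..n} :=
  [multinom if lcoef i == 0%R then 0%N else negn (z 0%R i) | i < n].
Let vec a : 'rV[int]_n := \row_i (a i)%:Z.
Let D : 'M[int]_(n, d) := \matrix_(i, j) if lcoef i == 0 then 0 else deg i 0 j.

Let pp_neq0 z : lcoefm (pp z) != 0.
Proof. by apply/lcoefm_neq0 => i; rewrite mnmE; case: (lcoef i == 0) => //=. Qed.

Let np_neq0 z : lcoefm (np z) != 0.
Proof. by apply/lcoefm_neq0 => i; rewrite mnmE; case: (lcoef i == 0) => //=. Qed.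

Let vecD a : lcoefm a != 0 -> vec a *m D = degm a.
Proof.
move=> /lcoefm_neq0 a0; apply/rowP => j; rewrite mxE /degm summxE.
apply: eq_bigr => i _; rewrite !mxE mulmxnE.
have [ai|/a0/negPf->] := eqVneq (a i) 0%N; first by rewrite ai mul0r mulr0n.
by rewrite mulrC -mulr_natr natz.
Qed.

Let ppnpD z : degm (pp z) - degm (np z) = z *m D.
Proof.
rewrite -!vecD ?pp_neq0 ?np_neq0 // -mulmxBl; apply/rowP => j; rewrite !mxE; apply: eq_bigr => i _.
rewrite !mxE !mnmE; case: eqP => _; first by rewrite !mulr0.
by rewrite posn_negn.
Qed.

Let rel_ppnp z : z *m D = 0 -> rel (pp z) (np z).
Proof. by rewrite -ppnpD => /subr0_eq e; split; rewrite ?pp_neq0 ?np_neq0. Qed.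

(** By [phi_shift], [phi a b] depends only on the difference of exponents; this is the resulting
    function on the relation lattice [z *m D = 0]. *)
Let Phi z := phi (pp z) (np z).

Let Phi_vec a b : rel a b -> Phi (vec a - vec b) = phi a b.
Proof.
move=> rab; have [a0 b0 ab] := rab; set z := vec a - vec b.
have zD : z *m D = 0 by rewrite mulmxBl !vecD // ab subrr.
have e : (pp z + b = np z + a)%MM.
  apply/mnmP => i; rewrite !mnmDE !mnmE; case: eqP => [i0|_].
    have h c : lcoefm c != 0 -> c i = 0%N.
      by move=> /lcoefm_neq0/(_ i); rewrite i0 eqxx; case: eqP => // _ /(_ isT).
    by rewrite !h.
  by rewrite !mxE posn_negnB.
rewrite /Phi -(phi_shift (rel_ppnp zD) b0) e addmC [X in phi X _]addmC.
by rewrite [X in phi X _]addmC [X in phi _ X]addmC phi_shift ?np_neq0 // addmC.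
Qed.

Let PhiD z z' : z *m D = 0 -> z' *m D = 0 -> Phi (z + z') = Phi z + Phi z'.
Proof.
move=> zD zD'; have zzD : (z + z') *m D = 0 by rewrite mulmxDl zD zD' addr0.
have [p0 n0 pn] := rel_ppnp zD; have [p0' n0' pn'] := rel_ppnp zD'.
set N := np (z + z').
have e : (pp (z + z') + (np z + np z') = pp z + pp z' + N)%MM.
  apply/mnmP => i; rewrite !mnmDE !mnmE; case: eqP => // _.
  by rewrite mxE posn_negnD.
have AB : rel (pp z + pp z')%MM (np z + np z')%MM.
  by split; rewrite ?lcoefmD ?mulf_neq0 // !degmD pn pn'.
transitivity (phi (pp z + pp z')%MM (np z + np z')%MM).
  rewrite -(phi_shift AB (np_neq0 (z + z'))) -/N -e [(_ + N)%MM]addmC phi_shift //.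
    exact: rel_ppnp.
  by rewrite lcoefmD mulf_neq0.
have M : rel (pp z + pp z')%MM (np z + pp z')%MM.
  by split; rewrite ?lcoefmD ?mulf_neq0 // !degmD pn.
have M' : rel (np z + pp z')%MM (np z + np z')%MM.
  by split; rewrite ?lcoefmD ?mulf_neq0 // !degmD pn'.
rewrite -(phi_trans M M') phi_shift //; congr (_ + _).
by rewrite ![(np z + _)%MM]addmC phi_shift.
Qed.

(** Since the degrees generate Z^d, [D] has a section [W], and [z - z *m D *m W] projects Z^n onto
    the relation lattice. Composed with this projection, [Phi] is additive on Z^n. Admissibility
    holds because [phi] is 0 where the target degree is outside S. *)
Lemma conormal_eta : exists2 eta, admissible eta &
  forall a b, lcoefm a != 0 -> lcoefm b != 0 -> degm a = degm b ->
    f (binom_rel a b) = eta_hom eta (binom_rel a b).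
Proof.
have [W WD] : exists W : 'M[int]_(d, n), W *m D = 1%:M.
  have /boolp.choice[w hw] : forall k : 'I_d, exists w : 'rV[int]_n,
      w *m D = delta_mx 0 k.
    move=> k; have [m1 [m2 [S1 S2 ->]]] := S_gen (delta_mx 0 k).
    have [a [a0 <-]] := monomial_of_degree S1; have [b [b0 <-]] := monomial_of_degree S2.
    by exists (vec a - vec b); rewrite mulmxBl !vecD.
  exists (\matrix_k w k); apply/row_matrixP => k.
  by rewrite row_mul rowK hw rowE mulmx1.
pose Psi z := Phi (z - z *m D *m W).
have kerP z : (z - z *m D *m W) *m D = 0 by rewrite mulmxBl -!mulmxA WD mulmx1 subrr.
have PsiD z z' : Psi (z + z') = Psi z + Psi z'.
  by rewrite /Psi -PhiD // !mulmxDl opprD addrACA.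
pose eta i := Psi (delta_mx 0 i).
have eta_phi a b : rel a b -> mval eta a - mval eta b = phi a b.
  move=> rab; have [a0 b0 ab] := rab; rewrite -Phi_vec //.
  have zD : (vec a - vec b) *m D = 0 by rewrite mulmxBl !vecD // ab subrr.
  transitivity (Psi (vec a - vec b)); last by rewrite /Psi zD mul0mx subr0.
  rewrite (additive_row_delta PsiD) /mval -sumrB; apply: eq_bigr => i _.
  by rewrite !mxE rmorphB mulrBl /= -!pmulrn !mulr_natl.
exists eta => a b a0 b0 ab; have rab : rel a b by split.
  by move=> nS; apply/eqP; rewrite -subr_eq0 eta_phi // phi_out.
by rewrite f_binom // eta_hom_binom_rel // eta_phi.
Qed.

End ConormalToEta.

(** The component of degree -chi of a derivation is again given by an eta vector, whose entry i is 0
    when [deg i - chi] is outside S. *)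
Lemma der_tcoef (h : 'I_n -> P) a : lcoefm a != 0 ->
  tcoef (degm a - chi) (ev (\sum_i h i * ('X_[a])^`M(i))) =
  lcoefm a * mval (fun i => tcoef (deg i - chi) (ev (h i)) / lcoef i) a.
Proof.
move=> a0; rewrite eval_gens_sum tcoef_sum mulr_sumr; apply: eq_bigr => i _.
rewrite mderivX eval_gensM eval_gensZ ev_monomial.
have [ai|ai] := eqVneq (a i) 0%N.
  by rewrite ai scale0r mulr0 tcoef0 mulr0n mulr0.
have ea : a = (U_(i) + (a - U_(i)))%MM.
  apply/mnmP => j; rewrite mnmDE mnmBE mnm1E; case: eqVneq => [<-|_] /=.
    by rewrite subnKC // lt0n.
  by rewrite subn0.
set b := (a - U_(i))%MM in ea *.
have la : lcoefm a = lcoef i * lcoefm b by rewrite ea lcoefmD lcoefmU.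
have da : degm a = deg i + degm b by rewrite ea degmD degmU.
have [i0 b0] : lcoef i != 0 /\ lcoefm b != 0.
  by move: a0; rewrite la mulf_eq0 negb_or => /andP[].
rewrite mulrC -scalerAl -scalerAl !tcoefZ tcoef_chrM (lcoefm_lattice b0) mul1r da la.
rewrite (_ : deg i + degm b - chi - degm b = deg i - chi); last first.
  by rewrite addrAC addrK.
by rewrite -mulr_natl; field.
Qed.

(** If the derivation has vector [eta'], then [eta - eta'] respects all relations and is linear;
    [eta'] vanishes on the generators in question. *)
Lemma eta_hom_in_der_image eta : admissible eta -> der_image x (eta_hom eta) ->
  exists l : 'cV[K]_d, forall i, lcoef i != 0 -> ~~ S (deg i - chi) ->
    eta i = linval l (deg i).
Proof.
move=> adm [h hE].
pose eta' i := tcoef (deg i - chi) (ev (h i)) / lcoef i.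
have [|l hl] := @linear_of_relations (fun i => lcoef i != 0) (fun i => eta i - eta' i).
  move=> a b /lcoefm_neq0 a0 /lcoefm_neq0 b0 ab.
  suff e : mval eta a - mval eta b = mval eta' a - mval eta' b.
    rewrite !mvalB; apply/eqP; rewrite -subr_eq0; apply/eqP.
    transitivity ((mval eta a - mval eta b) - (mval eta' a - mval eta' b)); first by ring.
    by rewrite e subrr.
  have := congr1 (tcoef (degm a - chi)) (hE _ (binom_rel_ideal a0 b0 ab)).
  rewrite eta_hom_binom_rel // tcoefZ tcoef_chr eqxx /=.
  pose Dh p := ev (\sum_i h i * p^`M(i)).
  have DhB (k k' : K) p q : Dh (k *: p - k' *: q) = k *: Dh p - k' *: Dh q.
    rewrite /Dh -!scaleNr -!eval_gensZ -eval_gensD; congr eval_gens.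
    rewrite !scaler_sumr -big_split; apply: eq_bigr => i _ /=.
    by rewrite mderivD !mderivZ mulrDr -!scalerAr.
  rewrite -[ev _]/(Dh (binom_rel a b)) DhB -scaleNr tcoefD !tcoefZ /Dh.
  rewrite der_tcoef // {2}ab der_tcoef // mulNr !mulKf // => e.
  have [SA|nS] := boolP (S (degm a - chi)); first by rewrite SA mulr1 in e.
  by rewrite (negPf nS) mulr0 in e; rewrite (adm a b) // subrr.
exists l => i i0 nS; have := hl i i0.
by rewrite /eta' tcoef_out // mul0r subr0.
Qed.

(** * The basis of hinges *)

Section Chain.
Hypothesis S_gen : forall m, exists m1 m2, [/\ S m1, S m2 & m = m1 - m2].
Variables (e : nat) (a : nat -> 'cV[int]_d).
Hypothesis chain : edge_chain S chi e a.
(** The form in which rank 3 enters the algebra: covectors orthogonal to a nonzero vector fill a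
    plane. *)
Hypothesis coplanar : forall (v : 'cV[int]_d) m1 m2 m3, v != 0 ->
  ipair m1 v = 0 -> ipair m2 v = 0 -> ipair m3 v = 0 ->
  exists k1 k2 k3 : K, [|| k1 != 0, k2 != 0 | k3 != 0] /\ forall l : 'cV[K]_d,
    k1 * linval l m1 + k2 * linval l m2 + k3 * linval l m3 = 0.

Lemma shift_notin m : S m -> ~~ S (m - chi) <-> exists2 j, (j < e)%N & ipair m (a j) = 0.
Proof.
move=> Sm; split=> [/negP nS|[j je mj]]; last first.
  by apply/negP => /(chain_shift chain Sm)/(_ j je); rewrite mj eqxx.
apply: contrapT => nj; apply: nS; apply/(chain_shift chain Sm) => j je.
by apply/eqP => mj; apply: nj; exists j.
Qed.

Lemma ipair_degm b j : ipair (degm b) (a j) = \sum_(i < n) ipair (deg i) (a j) *+ b i.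
Proof.
rewrite /degm (big_morph (fun m => ipair m (a j)) (id1 := 0) (op1 := +%R)).
- by apply: eq_bigr => i _; exact: ipairMn.
- by move=> m1 m2; exact: ipairDl.
- by rewrite /ipair mul0mx mxE.
Qed.

(** A sum of nonnegative terms is 0 only if each term is: facets are faces of the monoid. *)
Lemma facet_support b j : lcoefm b != 0 -> (j < e)%N -> ipair (degm b) (a j) = 0 ->
  forall i, b i != 0%N -> ipair (deg i) (a j) = 0.
Proof.
move=> /lcoefm_neq0 b0 je /eqP; rewrite ipair_degm psumr_eq0; last first.
  move=> i _; have [->|/b0/lcoef_lattice Si] := eqVneq (b i) 0%N; first by rewrite mulr0n.
  by apply: mulrn_wge0; exact: chain_ge0 chain _ _ Si je.
move=> /allP h i bi; have := h i (mem_index_enum i).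
by rewrite /= mulrn_eq0 (negPf bi) => /eqP.
Qed.

(** Monomials supported on a facet have degrees that leave S when shifted by chi, so admissibility
    applies to all relations between them. *)
Lemma facet_linear eta j : admissible eta -> (j < e)%N ->
  exists l : 'cV[K]_d, forall i, lcoef i != 0 -> ipair (deg i) (a j) = 0 ->
    eta i = linval l (deg i).
Proof.
move=> adm je.
have [|l hl] := @linear_of_relations
    (fun i => (lcoef i != 0) && (ipair (deg i) (a j) == 0)) eta; last first.
  by exists l => i i0 ij; apply: hl; rewrite i0 ij eqxx.
move=> b c hb hc bc.
have b0 : lcoefm b != 0 by apply/lcoefm_neq0 => i /hb/andP[].
have c0 : lcoefm c != 0 by apply/lcoefm_neq0 => i /hc/andP[].
apply: adm => //; apply/shift_notin; first exact: lcoefm_lattice.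
exists j => //; rewrite ipair_degm big1 // => i _.
by have [->|/hb/andP[_ /eqP->]] := eqVneq (b i) 0%N; rewrite ?mulr0n ?mul0rn.
Qed.

(* Zero on the facets 0, ..., j of the chain and equal to a_j on the later
   ones; these agree on common points by convexity. *)
Definition hinge (j : nat) (i : 'I_n) : K :=
  if [exists k : 'I_e, (j < k)%N && (ipair (deg i) (a k) == 0)]
  then (ipair (deg i) (a j))%:~R else 0.

Lemma hingeE j k i : lcoef i != 0 -> (j < e)%N -> (k < e)%N ->
  ipair (deg i) (a k) = 0 ->
  hinge j i = if (j < k)%N then (ipair (deg i) (a j))%:~R else 0.
Proof.
move=> i0 je ke ik; rewrite /hinge; case: ifP => [/existsP[k' /andP[jk' /eqP ik']]|/existsP nk].
  case: ltnP => // kj; rewrite (chain_convex chain kj (ltnW jk') (ltn_ord k')) //.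
  exact: lcoef_lattice.
by case: ifP => // jk; case: nk; exists (Ordinal ke); rewrite jk ik eqxx.
Qed.

Lemma mval_hinge j k b : lcoefm b != 0 -> (j < e)%N -> (k < e)%N ->
  ipair (degm b) (a k) = 0 ->
  mval (hinge j) b = if (j < k)%N then (ipair (degm b) (a j))%:~R else 0.
Proof.
move=> b0 je ke bk; have supp := facet_support b0 ke bk.
have -> : mval (hinge j) b =
    \sum_(i < n) (if (j < k)%N then (ipair (deg i) (a j))%:~R else 0) *+ b i.
  apply: eq_bigr => i _; have [->|bi] := eqVneq (b i) 0%N; first by rewrite !mulr0n.
  by rewrite (@hingeE j k) // ?supp //; move/lcoefm_neq0: b0; apply.
case: ifP => _; last by rewrite big1 // => i _; rewrite mul0rn.
by rewrite ipair_degm rmorph_sum; apply: eq_bigr => i _; rewrite rmorphMn.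
Qed.

Lemma hinge_admissible j : (j < e)%N -> admissible (hinge j).
Proof.
move=> je b c b0 c0 bc /(shift_notin (lcoefm_lattice b0))[k ke bk].
by rewrite !(@mval_hinge j k) // -?bc.
Qed.

Lemma admissible_sum N (k : 'I_N -> K) (H : 'I_N -> 'I_n -> K) :
  (forall j, admissible (H j)) -> admissible (fun i => \sum_j k j * H j i).
Proof.
move=> adm b c b0 c0 bc nS; rewrite !mval_sum.
by apply: eq_bigr => j _; rewrite (adm j b c).
Qed.

Lemma admissible_sub_linear eta eta' (l : 'cV[K]_d) :
  admissible eta -> admissible eta' ->
  admissible (fun i => eta i - linval l (deg i) - eta' i).
Proof.
move=> adm adm' b c b0 c0 bc nS; rewrite !mvalB -!linval_degm bc.
by rewrite (adm b c) // (adm' b c).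
Qed.

Lemma hinge_span eta t : admissible eta -> (t < e)%N ->
  exists (l : 'cV[K]_d) (k : 'I_(e - 2) -> K), forall s i, (s <= t)%N ->
    lcoef i != 0 -> ipair (deg i) (a s) = 0 ->
    eta i = linval l (deg i) + \sum_j k j * hinge j.+1 i.
Proof.
move=> adm; elim: t => [|t IH] te.
  have [l hl] := facet_linear adm te.
  exists l, (fun=> 0) => s i; rewrite leqn0 => /eqP-> i0 ij.
  by rewrite -hl // big1 ?addr0 // => j _; rewrite mul0r.
have te' := ltnW te; have [l [k hk]] := IH te'.
pose eta' i := eta i - linval l (deg i) - \sum_(j < e - 2) k j * hinge j.+1 i.
have hingeA (j : 'I_(e - 2)) : admissible (hinge j.+1).
  by apply: hinge_admissible; have := ltn_ord j; lia.
have adm' : admissible eta' by exact: admissible_sub_linear adm (admissible_sum k hingeA).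
have eta'0 s i : (s <= t)%N -> lcoef i != 0 -> ipair (deg i) (a s) = 0 -> eta' i = 0.
  by move=> st i0 his; rewrite /eta' (hk s) // -addrA -opprD subrr.
have [g hg] := facet_linear adm' te.
have mval_g b : lcoefm b != 0 -> ipair (degm b) (a t.+1) = 0 ->
    mval eta' b = linval g (degm b).
  move=> b0 bt; rewrite linval_degm; apply: eq_bigr => i _.
  have [->|bi] := eqVneq (b i) 0%N; first by rewrite !mulr0n.
  by rewrite hg ?(facet_support b0 te bt) //; move/lcoefm_neq0: b0; apply.
(* On the ray shared by the facets [t] and [t.+1] the remainder [eta'] is already 0, hence so is
   [g]. *)
have [u [Su un0 ut ut1]] := chain_consecutive chain te.
have gu : linval g u = 0.
  have [b [b0 bu]] := monomial_of_degree Su; rewrite -bu -mval_g ?bu //.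
  rewrite /mval big1 // => i _; have [->|bi] := eqVneq (b i) 0%N; first by rewrite mulr0n.
  rewrite (eta'0 t) ?mul0rn ?(facet_support b0 te') ?bu //.
  by move/lcoefm_neq0: b0; apply.
have [w [Sw wt1 wpos]] := chain_exposed chain te.
have wt : 0 < ipair w (a t) by apply: wpos => //; rewrite neq_ltn ltnSn.
pose al : K := linval g w / (ipair w (a t))%:~R.
have wtK : (ipair w (a t))%:~R != 0 :> K by rewrite intr_eq0 gt_eqF.
have at1 : a t.+1 != 0.
  apply/eqP => a0; have := chain_height chain te.
  by rewrite a0 /ipair mulmx0 mxE.
(* In the plane orthogonal to a_(t+1), both [g] and a_t vanish at [u], while a_t is positive at [w].
   The dependence of [m], [u], [w] then gives [g] as a multiple of a_t, and [al] is the ratio at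
   [w]. *)
have gal m : ipair m (a t.+1) = 0 -> linval g m = al * (ipair m (a t))%:~R.
  move=> mt; have [k1 [k2 [k3 [kn0 dep]]]] := coplanar at1 mt ut1 wt1.
  have := dep g; rewrite gu mulr0 addr0 => dg.
  have := dep (map_mx intr (a t)); rewrite !linval_intr ut mulr0 addr0 => da.
  have k1n : k1 != 0.
    apply/eqP => k10; move: kn0 da; rewrite k10 eqxx mul0r add0r /= => kn0 /eqP.
    rewrite mulf_eq0 (negPf wtK) orbF => /eqP k30; move: kn0; rewrite k30 eqxx orbF => k2n.
    case/negP: un0; apply/eqP/rowP => j; rewrite mxE.
    have := dep (delta_mx j 0); rewrite k10 k30 !mul0r add0r addr0 => /eqP.
    rewrite mulf_eq0 (negPf k2n) /= /linval (bigD1 j) //= mxE !eqxx mulr1 big1 ?addr0.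
      by rewrite intr_eq0 => /eqP.
    by move=> i ij; rewrite mxE (negPf ij) mulr0.
  apply: (mulfI k1n); apply: (mulIf wtK).
  transitivity (- (k3 * linval g w) * (ipair w (a t))%:~R).
    by congr (_ * _); apply/eqP; rewrite -addr_eq0 dg.
  transitivity (- (k3 * (ipair w (a t))%:~R) * linval g w); first by ring.
  have -> : - (k3 * (ipair w (a t))%:~R) = k1 * (ipair m (a t))%:~R.
    by apply/eqP; rewrite eq_sym -addr_eq0 da.
  by rewrite /al; field.
have eta't i : lcoef i != 0 -> ipair (deg i) (a t.+1) = 0 ->
    eta' i = al * (ipair (deg i) (a t))%:~R.
  by move=> i0 it; rewrite hg // gal.
(* From facet 0 to facet 1: a_0 vanishes on facet 0, so [al] times a_0 joins the linear form. The
   hinges therefore start at index 1; they end at e - 2, as a hinge at the last facet is zero on all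
   facets. *)
case: t => [|t] in IH te te' hk eta'0 hg mval_g u Su un0 ut ut1 gu
    w Sw wt1 wpos wt al wtK at1 gal eta't *.
  exists (l + al *: map_mx intr (a 0%N)), k => s i s1 i0 his.
  have linD (l1 l2 : 'cV[K]_d) m : linval (l1 + l2) m = linval l1 m + linval l2 m.
    by rewrite -big_split; apply: eq_bigr => j _; rewrite mxE mulrDr.
  have linZ (k1 : K) (l1 : 'cV[K]_d) m : linval (k1 *: l1) m = k1 * linval l1 m.
    by rewrite /linval mulr_sumr; apply: eq_bigr => j _; rewrite mxE mulrCA.
  rewrite linD linZ linval_intr addrAC; apply/eqP; rewrite addrC -subr_eq opprD addrA.
  rewrite -[X in X == _]/(eta' i); apply/eqP.
  move: s1 his; rewrite leq_eqVlt ltnS leqn0 => /orP[] /eqP -> his; first exact: eta't.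
  by rewrite (eta'0 0%N) // his mulr0.
have t2 : (t < e - 2)%N by lia.
(* [Ordinal t2] selects [hinge t.+1], which vanishes on the facets treated so far and equals a_(t+1)
   on facet [t.+2]. *)
exists l, (fun j => k j + if j == Ordinal t2 then al else 0) => s i st i0 his.
under eq_bigr do rewrite mulrDl.
rewrite big_split /= [X in _ + (_ + X)](bigD1 (Ordinal t2)) //= eqxx.
rewrite [X in _ + (_ + (_ + X))]big1 ?addr0; last first.
  by move=> j /negPf->; rewrite mul0r.
apply/eqP; rewrite addrA addrC -subr_eq opprD addrA -[X in X == _]/(eta' i); apply/eqP.
move: st; rewrite leq_eqVlt ltnS => /predU1P[es|st].
  by rewrite es in his; rewrite eta't // (@hingeE _ t.+2) // ltnSn.
rewrite (eta'0 s) // (@hingeE _ s) //; last by apply: leq_ltn_trans te'.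
by rewrite ltnNge st mulr0.
Qed.

(** Facets 0 and 1, where all these hinges vanish, force [l = 0]. On the later facets the system in
    [k] is triangular. *)
Lemma hinge_free (k : 'I_(e - 2) -> K) (l : 'cV[K]_d) :
  (forall i, lcoef i != 0 -> ~~ S (deg i - chi) ->
     \sum_j k j * hinge j.+1 i = linval l (deg i)) ->
  forall j, k j = 0.
Proof.
move=> kl j0; have e2 : (2 < e)%N by have := ltn_ord j0; lia.
have je (j : 'I_(e - 2)) : (j.+1 < e)%N by have := ltn_ord j; lia.
have val_l m s : S m -> (s < e)%N -> ipair m (a s) = 0 ->
    \sum_j k j * (if (j.+1 < s)%N then (ipair m (a j.+1))%:~R else 0) = linval l m.
  move=> Sm se ms; have [b [b0 bm]] := monomial_of_degree Sm.
  transitivity (\sum_j k j * mval (hinge j.+1) b).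
    by apply: eq_bigr => j _; rewrite (@mval_hinge _ s) ?bm.
  rewrite -bm linval_degm; under eq_bigr do rewrite /mval mulr_sumr.
  rewrite exchange_big; apply: eq_bigr => i _.
  have [->|bi] := eqVneq (b i) 0%N; first by rewrite big1 // => j _; rewrite mulr0n mulr0.
  have i0 : lcoef i != 0 by move/lcoefm_neq0: b0; apply.
  have his : ipair (deg i) (a s) = 0 by apply: (facet_support b0 se); rewrite ?bm.
  rewrite -kl //; last by apply/shift_notin; [exact: lcoef_lattice | exists s].
  by rewrite -sumrMnl; apply: eq_bigr => j _; rewrite mulrnAr.
have l_fac m : ipair m (a 0%N) = 0 -> linval l m = 0.
  move=> m0; have [|u1 [u2 [S1 S2 u10 u20 ->]]] := chain_facet_span chain _ m0; first by lia.
  rewrite linvalD linvalN -!(@val_l _ 0%N) //; try lia.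
  by rewrite !big1 ?subrr // => j _; rewrite mulr0.
(* As [l] vanishes on the plane orthogonal to a_0, it is a multiple of a_0; the factor is read off
   at chi, which has height 1 there. *)
have lE m : linval l m = linval l chi * (ipair m (a 0%N))%:~R.
  have c0 : ipair chi (a 0%N) = 1 by apply: chain_height chain _ _; lia.
  have := l_fac (m - ipair m (a 0%N) *: chi).
  have -> : ipair (m - ipair m (a 0%N) *: chi) (a 0%N) = 0.
    by rewrite ipairDl ipairNl {2}/ipair -scalemxAl mxE -/(ipair _ _) c0 mulr1 subrr.
  have -> : linval l (m - ipair m (a 0%N) *: chi) =
      linval l m - (ipair m (a 0%N))%:~R * linval l chi.
    rewrite linvalD linvalN; congr (_ - _); rewrite /linval mulr_sumr.
    by apply: eq_bigr => j _; rewrite mxE rmorphM mulrA.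
  by move=> /(_ erefl)/subr0_eq ->; rewrite mulrC.
have l0 m : linval l m = 0.
  have [|w [Sw w1 wpos]] := chain_exposed chain (j := 1%N); first by lia.
  have /esym/eqP := val_l w 1%N Sw (ltnW e2) w1.
  rewrite big1 => [|j _]; last by rewrite mulr0.
  rewrite lE mulf_eq0 intr_eq0 => /orP[/eqP c0|]; first by rewrite lE c0 mul0r.
  by rewrite gt_eqF // wpos //; lia.
suff h N (j : 'I_(e - 2)) : (j < N)%N -> k j = 0 by exact: (h _ j0 (ltnSn _)).
elim: N j => // N IH j jN.
have j2 : (j.+2 < e)%N by have := ltn_ord j; lia.
(* At [w] on facet [j.+2], hinges with larger index vanish and smaller ones have coefficient 0 by
   induction. What remains is [k j] times the positive value of a_(j+1). *)
have [w [Sw wj wpos]] := chain_exposed chain j2.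
have := val_l w j.+2 Sw j2 wj; rewrite l0 (bigD1 j) //= ltnSn big1 => [|j' jj'].
  rewrite addr0 => /eqP; rewrite mulf_eq0 => /orP[/eqP //|].
  by rewrite intr_eq0 gt_eqF // wpos ?neq_ltn ?ltnSn // ltnW.
case: ltnP => [lt|_]; last by rewrite mulr0.
by rewrite IH ?mul0r //; move: jj'; rewrite -val_eqE /=; lia.
Qed.

Lemma T1_dim_chain : (0 < e)%N -> T1_dim gr x deg (- chi) (e - 2).
Proof.
move=> e0; have je (j : 'I_(e - 2)) : (j.+1 < e)%N by have := ltn_ord j; lia.
have adm (j : 'I_(e - 2)) : admissible (hinge j.+1) by exact: hinge_admissible.
have sumE (k : 'I_(e - 2) -> K) p :
    (\sum_i k i *: (eta_hom (hinge i.+1) : P -> A)) p =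
    eta_hom (fun i => \sum_j k j * hinge j.+1 i) p.
  rewrite eta_hom_sum; elim/big_rec2: _ => // j y z _ <-; by [].
exists (fun j => eta_hom (hinge j.+1)); split=> [j|f f_homog|k [h hE] ].
- exact: eta_hom_homog.
- have [eta etaA f_eta] := conormal_eta S_gen f_homog.
  (* The bound [e.-1] covers all facets. The remainder [eta'] is then 0 wherever [deg i - chi]
     leaves S, so it comes from a derivation. *)
  have [|l [k hk]] := @hinge_span eta e.-1 etaA; first by lia.
  exists k.
  pose eta' i := eta i - linval l (deg i) - \sum_j k j * hinge j.+1 i.
  have [h' h'E] : exists h : 'I_n -> P, forall p, eta_hom eta' p = ev (\sum_i h i * p^`M(i)).
    apply: eta_hom_der => i i0; apply: contraNT => nS; apply/eqP.
    have [s se his] := (shift_notin (lcoef_lattice i0)).1 nS.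
    rewrite /eta' (hk s) //; last by lia.
    by rewrite -addrA -opprD subrr.
  (* A second derivation reproduces [f] on the zero generators. It kills the binomials between
     monomials of nonzero coefficient, which do not involve those variables. *)
  have /boolp.choice[h hE] : forall i, exists p, ev p = if lcoef i == 0 then f 'X_i else 0.
    by move=> i; exact: x_gen.
  exists (fun i => h' i + h i) => g xg.
  have fE : f g = eta_hom eta g + ev (\sum_i h i * g^`M(i)).
    have [f_con _] := f_homog; move: g xg; apply: conormal_hom_eq => //.
      exact: conormal_homD (eta_hom_conormal etaA) (conormal_hom_der x h).
      move=> b c b0 c0 bc; rewrite f_eta // eval_gens_sum big1 ?addr0 // => i _.
      rewrite eval_gensM hE; case: eqP => [i0|_]; last by rewrite mul0r.
      have z d' : lcoefm d' != 0 -> ('X_[d'])^`M(i) = 0 :> P.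
        move=> /lcoefm_neq0/(_ i); rewrite i0 eqxx mderivX.
        by case: eqP => [-> _|_ /(_ isT)//]; rewrite scale0r.
      by rewrite /binom_rel mderivB !mderivZ !z // !scaler0 subrr eval_gens0 mulr0.
    move=> i i0; rewrite /eta_hom lextX lcoefmU i0 mul0r scale0r add0r.
    rewrite (bigD1 i) //= big1 ?addr0 => [|j ji]; last first.
      by rewrite mderivX mnm1E eq_sym (negPf ji) scale0r mulr0.
    rewrite mderivX mnm1E eqxx scale1r eval_gensM hE i0 eqxx.
    rewrite (_ : (U_(i) - U_(i))%MM = 0%MM); last first.
      by apply/mnmP => j; rewrite mnmBE mnm0E subnn.
    by rewrite mpolyX0 /eval_gens rmorph1 mulr1.
  transitivity (f g - (\sum_i k i *: (eta_hom (hinge i.+1) : P -> A)) g); first by [].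
  rewrite sumE fE.
  have -> : eta_hom eta g = eta_hom eta' g + eta_hom (fun i => \sum_j k j * hinge j.+1 i) g.
    rewrite -[LHS]addr0 -[in LHS](eta_hom_linear (- l) xg) -!eta_homD.
    apply: eq_eta_hom => i _; rewrite /eta' subrK -[- l]sub0r linval_subl.
    by rewrite /linval big1 ?sub0r // => j _; rewrite mxE mulr0.
  rewrite addrAC addrK h'E -eval_gensD -big_split; congr eval_gens.
  by apply: eq_bigr => i _; rewrite mulrDl.
have kA := admissible_sum k adm.
have [|l hl] := @eta_hom_in_der_image _ kA.
  by exists h => g /hE <-; rewrite sumE.
exact: hinge_free hl.
Qed.

End Chain.

End GradedPresentation.

(** The square matrix with rows [m1], [m2], [m3] kills [v], so it is singular and its rows are
    dependent. *)
Lemma coplanar_dependent (K : numFieldType) (v : 'cV[int]_3) (m1 m2 m3 : 'rV[int]_3) :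
  v != 0 -> ipair m1 v = 0 -> ipair m2 v = 0 -> ipair m3 v = 0 ->
  exists k1 k2 k3 : K, [|| k1 != 0, k2 != 0 | k3 != 0] /\ forall l : 'cV[K]_3,
    k1 * linval l m1 + k2 * linval l m2 + k3 * linval l m3 = 0.
Proof.
move=> v0 mv1 mv2 mv3; pose ms := [tuple m1; m2; m3].
pose M : 'M[K]_3 := \matrix_(i, j) (tnth ms i 0 j)%:~R.
have Ml (l : 'cV[K]_3) i : (M *m l) i 0 = linval l (tnth ms i).
  by rewrite mxE; apply: eq_bigr => j _; rewrite mxE.
have msv i : ipair (tnth ms i) v = 0.
  by case: i => [[|[|[|//]]] hi]; rewrite (tnth_nth 0).
have : \det M == 0.
  rewrite -det_tr; apply/det0P; exists (map_mx intr v)^T.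
    apply: contra_neq v0 => /(congr1 trmx); rewrite trmxK trmx0 => v0.
    apply/colP => j; have := congr1 (fun A : 'cV_3 => A j 0) v0.
    by rewrite !mxE => /eqP; rewrite intr_eq0 => /eqP.
  rewrite -trmx_mul; apply/rowP => i.
  by rewrite mxE Ml linval_intr msv mxE.
case/det0P => w w0 wM.
have I3 (F : 'I_3 -> K) : \sum_i F i = F (inord 0) + F (inord 1) + F (inord 2).
  rewrite !big_ord_recl big_ord0 addr0 addrA.
  by congr (F _ + F _ + F _); apply/val_inj; rewrite /= inordK.
have tn k (hk : (k < 3)%N) : tnth ms (inord k) = nth 0 ms k.
  by rewrite (tnth_nth 0) inordK.
exists (w 0 (inord 0)), (w 0 (inord 1)), (w 0 (inord 2)); split=> [|l].
  apply: contra_neqT w0; rewrite !negb_or !negbK => /and3P[/eqP h0 /eqP h1 /eqP h2].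
  apply/rowP => j; rewrite mxE -(inord_val j).
  by case: (nat_of_ord j) (ltn_ord j) => [|[|[|//]]].
have := congr1 (fun A : 'rV_3 => (A *m l) 0 0) wM.
by rewrite -mulmxA mul0mx !mxE I3 !Ml !tn.
Qed.

Lemma num_negative_edgesE d (C : set 'cV[rat]_d) (chi : 'rV[int]_d) :
  num_negative_edges C chi = num_positive_edges C (- chi).
Proof.
congr #|` fset_set _|; apply/seteqP; split=> F [eF hF]; split=> // y Fy y0.
  by rewrite ratmxN pairingNl oppr_gt0 hF.
by have := hF y Fy y0; rewrite ratmxN pairingNl oppr_gt0.
Qed.

(** Truncated subtraction gives 0 for a single positive edge, so one formula covers both cases. *)
Lemma toric_T1_dim (K : numFieldType) (tau : set 'cV[rat]_3) (chi : 'rV[int]_3)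
    n (x : 'I_n -> toric_ring K tau) (deg : 'I_n -> 'rV[int]_3) :
  polyhedral_cone tau -> pointed tau -> cone_dim tau 3 -> changes_sign tau chi ->
  lattice_crossings tau chi ->
  homogeneous_generators (@toric_homog K 3 tau) x deg ->
  (0 < num_positive_edges tau chi)%N ->
  T1_dim (@toric_homog K 3 tau) x deg (- chi) (num_positive_edges tau chi - 2).
Proof.
move=> tau_poly tau_pt tau_full chi_sign chi_lat [x_homog x_gen] e0.
have [a chain] := positive_edge_chain tau_poly tau_pt tau_full chi_sign chi_lat.
have [s0 tau_s0] := polyhedral_cone_seq tau_poly.
have [s [s0s s_irr]] := irredundant_generators s0.
have tau_s y : tau y <-> cone s y by rewrite tau_s0 s0s.
apply: (T1_dim_chain (tcoef := @tcoef K 3 tau) (chr := @chr K 3 tau)) chain _ e0.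
- exact: dual_lattice0.
- exact: dual_latticeD.
- exact: tcoef_is_linear.
- exact: tcoef_inj.
- exact: tcoef_out.
- exact: tcoef_chr.
- exact: chrM.
- exact: tcoef_chrM.
- exact: chr0.
- exact: chr_out.
- exact: toric_homogP.
- exact: x_homog.
- exact: x_gen.
- by move=> m; exact: dual_lattice_generates tau_s m tau_pt s_irr.
- exact: coplanar_dependent.
Qed.

Theorem corollary5p20 (R : realType)
  (tau : set 'cV[rat]_3) (chi0 : 'rV[int]_3)
  (tau_polyhedral : polyhedral_cone tau)
  (tau_pointed : pointed tau)
  (tau_full : cone_dim tau 3)
  (chi0_primitive : primitive chi0)
  (chi0_sign : changes_sign tau chi0)
  (chi0_lattice : lattice_crossings tau chi0)
  (n : nat) (x : 'I_n -> toric_ring R[i] tau) (deg : 'I_n -> 'rV[int]_3)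
  (x_gen : homogeneous_generators (@toric_homog R[i] 3 tau) x deg) :
  let dimT1 := T1_dim (@toric_homog R[i] 3 tau) x deg in
  [/\ num_positive_edges tau chi0 = 1%N -> dimT1 (- chi0) 0%N,
      num_negative_edges tau chi0 = 1%N -> dimT1 (- (- chi0)) 0%N,
      (2 <= num_positive_edges tau chi0)%N ->
        dimT1 (- chi0) (num_positive_edges tau chi0 - 2)%N &
      (2 <= num_negative_edges tau chi0)%N ->
        dimT1 (- (- chi0)) (num_negative_edges tau chi0 - 2)%N].
Proof.
have sign_opp : changes_sign tau (- chi0).
  have [[y ty y0] [z tz z0]] := chi0_sign; split; [exists z | exists y] => //.
    by rewrite ratmxN pairingNl oppr_gt0.
  by rewrite ratmxN pairingNl oppr_lt0.
have lattice_opp : lattice_crossings tau (- chi0).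
  move=> F y eF Fy; rewrite ratmxN pairingNl => h; apply: (chi0_lattice F y eF Fy).
  by case: h => h; [right | left]; rewrite -[LHS]opprK h ?opprK.
have pos := toric_T1_dim tau_polyhedral tau_pointed tau_full chi0_sign chi0_lattice x_gen.
have neg := toric_T1_dim tau_polyhedral tau_pointed tau_full sign_opp lattice_opp x_gen.
move=> dimT1; rewrite !num_negative_edgesE; split=> he.
- by have := pos; rewrite he; apply.
- by have := neg; rewrite he; apply.
- by apply: pos; exact: ltnW.
- by apply: neg; exact: ltnW.
Qed.
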